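(* Let $B$ be any constant with $0<B<A$. As the positive integer $i\to\infty$, the following hold. (1) With $N=\mathrm{lcm}(1,2,\dots,i)$ (the case $a_1/b_1=0/1$, $a_2/b_2=1/0$), $$P\left(\frac01,\frac{1}{N/i}\right)=\sum_{j=1}^{I_N\left(\frac{1}{N/i}\right)}\left|F_N(j)-\frac{j}{|F_N|}\right|=O\big(\log(N)\,\delta_B(\log N)\big).$$ (2) With $N=2\,\mathrm{lcm}(1,2,\dots,i)$ (the case $a_1/b_1=1/2$, $a_2/b_2=0/1$), $$P\left(\frac12,\frac{N/(2i)}{N/i+1}\right)=O\big(\log(N)\,\delta_B(\log N)\big),$$ and likewise (the case $a_1/b_1=1/2$, $a_2/b_2=1/1$) $$P\left(\frac12,\frac{N/(2i)+1}{N/i+1}\right)=O\big(\log(N)\,\delta_B(\log N)\big).$$ (3) Let $a_1/b_1$ and $a_2/b_2$ be a Farey pair with $b_1>2$ and $b_2<b_1$, and let $N=b_1\,\mathrm{lcm}(1,2,\dots,i)$. Then $$P\left(\frac{a_1}{b_1},\ \frac{a_1\frac{N}{b_1i}+a_2}{b_1\frac{N}{b_1i}+b_2}\right)\ \le\ \left|\frac{a_1}{b_1}-\frac{I_N\left(\frac{a_1}{b_1}\right)}{|F_N|}\right|O(iN)+O(i\,\delta_B(i)).$$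
   Context: For a positive integer $N$, the Farey sequence $F_N$ is the ascending sequence of irreducible fractions in $[0,1]$ (including $0/1$ and $1/1$) whose denominators do not exceed $N$; $|F_N|$ is its number of elements and $F_N(n)$ is its $n$-th element ($F_N(1)=0/1$). $I_N(a/b)$ is the position that $a/b$ occupies in $F_N$, i.e. $F_N(I_N(a/b))=a/b$. The partial Franel sum between two elements $x,y$ of $F_N$ is $$P(x,y)=\sum_{n}\left|F_N(n)-\frac{n}{|F_N|}\right|,$$ where $n$ runs over all integers between $I_N(x)$ and $I_N(y)$ inclusive (from $I_N(x)$ to $I_N(y)$ if $x\le y$, from $I_N(y)$ to $I_N(x)$ if $y<x$). The dependence of $P$ on $N$ is suppressed. Two elements $a_1/b_1$ and $a_2/b_2$ of a Farey sequence, written in lowest terms, form a Farey pair if $|a_1b_2-a_2b_1|=1$ (exceptionally, $0/1$ and $1/0$ are also allowed to form a Farey pair). For $A>0$, $$\delta_A(x)=\exp\left(-A\,\frac{(\log x)^{0.6}}{(\log\log x)^{0.2}}\right),$$ and $\delta_B$ is defined by the same formula with $B$ in place of $A$. Here $A>0$ is a fixed constant for which the known estimate $E(x)=xH(x)+O(x\delta_A(x))$ holds, where, with $\varphi$ Euler's totient function, $E(x)=\sum_{k\le x}\varphi(k)-\frac{3}{\pi^2}x^2$ and $H(x)=\sum_{k\le x}\frac{\varphi(k)}{k}-\frac{6}{\pi^2}x$; such an $A$ is known to exist (Walfisz). The $O$-estimates are for all sufficiently large $i$, with implied constants depending only on $A$ and $B$. *)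

(* Defs.v *)
From HB Require Import structures.
From mathcomp Require Import all_boot all_order all_algebra.
From mathcomp Require Import all_classical all_reals all_analysis.

Set Implicit Arguments.
Unset Strict Implicit.
Unset Printing Implicit Defensive.

Import Order.TTheory GRing.Theory Num.Theory.
Import numFieldNormedType.Exports.

Local Open Scope ring_scope.

(* Every element is produced exactly once, since only coprime pairs (a, b)
   with a <= b are enumerated. *)
Definition farey (N : nat) : seq rat :=
  sort <=%O [seq a%:R / b%:R
            | b <- iota 1 N, a <- [seq a <- iota 0 b.+1 | coprime a b]].

(* Positions are counted from 1. *)
Definition farey_nth (N n : nat) : rat := nth 0 (farey N) n.-1.

Definition farey_pos (N : nat) (x : rat) : nat := (index x (farey N)).+1.

Definition franel_term (R : realType) (N n : nat) : R :=
  `|ratr (farey_nth N n) - n%:R / (size (farey N))%:R|.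

Definition partial_franel (R : realType) (N : nat) (x y : rat) : R :=
  \sum_(minn (farey_pos N x) (farey_pos N y) <= n
        < (maxn (farey_pos N x) (farey_pos N y)).+1) franel_term R N n.

Definition farey_fraction (a b : nat) : bool :=
  [&& (0 < b)%N, (a <= b)%N & coprime a b].

(* The pair (a, b) stands for a/b, so (1, 0) is the formal fraction 1/0. *)
Definition farey_pair (f g : nat * nat) : bool :=
  [|| [&& farey_fraction f.1 f.2, farey_fraction g.1 g.2 &
          `|(f.1 * g.2)%:Z - (g.1 * f.2)%:Z| == 1],
      (f == (0, 1)%N) && (g == (1, 0)%N) |
      (f == (1, 0)%N) && (g == (0, 1)%N)].

Definition lcm_upto (i : nat) : nat := \big[lcmn/1%N]_(1 <= k < i.+1) k.

Definition delta (R : realType) (A x : R) : R :=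
  expR (- A * (ln x `^ (3 / 5) / ln (ln x) `^ (1 / 5))).

Definition totient_error (R : realType) (x : R) : R :=
  \sum_(1 <= k < (Num.truncn x).+1) (totient k)%:R - 3 / pi ^+ 2 * x ^+ 2.

Definition totient_ratio_error (R : realType) (x : R) : R :=
  \sum_(1 <= k < (Num.truncn x).+1) ((totient k)%:R / k%:R) - 6 / pi ^+ 2 * x.

(* Lets the Landau notation [f =O_ (pinfty_nbhs R) g] be used as x --> +oo. *)
Canonical pinfty_nbhs_filter_on (R : numFieldType) :=
  FilterType (pinfty_nbhs R) _.

(* Main.v *)
Require Import Defs.
From HB Require Import structures.
From mathcomp Require Import all_boot all_order all_algebra.
From mathcomp Require Import all_classical all_reals all_analysis.
From mathcomp Require Import zify ring lra.

Set Implicit Arguments.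
Unset Strict Implicit.
Unset Printing Implicit Defensive.

Import Order.TTheory GRing.Theory Num.Theory.
Import numFieldNormedType.Exports.

Local Open Scope classical_set_scope.
Local Open Scope ring_scope.

(* Near a1/b1 the elements of F_N are parametrised by coprime pairs (p, q) via
   (a1 p + a2 q) / (b1 p + b2 q).  The number of elements between a1/b1 and the
   one with coordinates (p, q) is a sum over q' of counts of integers coprime to
   q' in intervals; with L = lcm(1..i) and t = N q / (b1 p + b2 q) in [q, i] it
   equals L (T(t) - S(t) / t) + O(i^2), where S and T are the summatory functions
   of phi(k) and phi(k) / k.  Walfisz' estimate says exactly that
   T(t) - S(t) / t = 3 t / pi^2 + O(delta_A(t)), while N times the distance to
   a1/b1 is t / b1; so every element inherits the discrepancy of a1/b1 up to
   O(L delta_A(t) + i^2) / |F_N|.  As t >= q, at most L u elements have t < u,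
   and cutting at u = i delta_B(i) bounds the sum.  The remaining errors are
   harmless because L is exponentially large in i, since m 'C(2m, m)
   divides lcm(1..2m). *)

(** * Coprime residues and lattice points *)

(** Two main terms have to cancel: the distance L t / N^2 from a1/b1, and the count c L t divided by
    |F_N|. So |F_N| ~ c N^2 must carry the same constant as T(t) - S(t)/t ~ c t. Both are drawn from
    the one hypothesis on phi, and the value of c never matters beyond 6/pi^2 being twice 3/pi^2. A
    relative error O(1/i^2) in |F_N| is affordable: it shifts each of at most L i elements by at
    most O(L i / i^2) / |F_N|, which adds up to O(1). The gap between A and B pays for comparing
    delta at the cut-off, of size i^(1 - o(1)), with delta at i. Parts (1) and (2) also replace i by
    log N, so there an intermediate exponent splits the gap in two. In them the centre is 0 or 1/2,
    whose discrepancy is at most 1/|F_N|: 0 has position 1, and 1/2 is the fixed point of the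
    symmetry z -> 1 - z. Its total contribution is then O(1). *)

Lemma totient_le (n : nat) : (totient n <= n)%N.
Proof.
rewrite totient_count_coprime.
apply: (@leq_trans (\sum_(0 <= d < n) 1)); last by rewrite sum_nat_const_nat; lia.
by apply: leq_sum => k _; case: coprime.
Qed.

Definition coprime_count (q n : nat) : nat := \sum_(0 <= p < n) coprime p q.

Lemma coprime_countS (q n : nat) :
  coprime_count q n.+1 = (coprime_count q n + coprime n q)%N.
Proof. by rewrite /coprime_count big_nat_recr. Qed.

Lemma coprime_count_shift (q n : nat) :
  coprime_count q (q + n) = (totient q + coprime_count q n)%N.
Proof.
elim: n => [|n IH].
  rewrite addn0 {2}/coprime_count big_geq // addn0 totient_count_coprime.
  by apply: eq_bigr => d _; rewrite coprime_sym.
by rewrite addnS !coprime_countS IH addnA ![coprime _ q]coprime_sym /coprime gcdnDl.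
Qed.

Lemma coprime_count_le (q n : nat) : (coprime_count q n <= n)%N.
Proof.
elim: n => [|n IH]; first by rewrite /coprime_count big_geq.
by rewrite coprime_countS; case: coprime; lia.
Qed.

(** Both terms of the difference grow by [totient q] when n grows by q, so the difference is
    periodic and only n < q matters; there both terms lie in [0, q]. *)
Lemma coprime_count_bound (R : realFieldType) (q n : nat) : (0 < q)%N ->
  `|(coprime_count q n)%:R - n%:R * (totient q)%:R / q%:R| <= q%:R :> R.
Proof.
move=> q_gt0; have qR : (0 : R) < q%:R by rewrite ltr0n.
elim/ltn_ind: n => n IH; case: (ltnP n q) => [n_lt|q_le].
  have h1 : ((coprime_count q n)%:R <= n%:R :> R) by rewrite ler_nat coprime_count_le.
  have h2 : n%:R * (totient q)%:R / q%:R <= n%:R :> R.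
    rewrite -mulrA ler_piMr // ?ler0n // ler_pdivrMr // mul1r ler_nat.
    exact: totient_le.
  have h3 : n%:R <= q%:R :> R by rewrite ler_nat ltnW.
  have h4 : 0 <= n%:R * (totient q)%:R / q%:R :> R by rewrite !mulr_ge0 ?invr_ge0.
  have h5 : 0 <= (coprime_count q n)%:R :> R by [].
  by rewrite ler_norml; apply/andP; split; lra.
have -> : n = (q + (n - q))%N by lia.
rewrite coprime_count_shift !natrD !mulrDl [q%:R * _]mulrC mulfK ?gt_eqF //.
rewrite opprD addrACA subrr add0r; apply: IH; lia.
Qed.

Lemma coprime_count_interval (R : realFieldType) (q m n : nat) :
  (0 < q)%N -> (m <= n)%N ->
  `|(\sum_(m <= p < n) coprime p q)%N%:R - (n%:R - m%:R) * (totient q)%:R / q%:R|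
    <= 2 * q%:R :> R.
Proof.
move=> q_gt0 le_mn.
have E : coprime_count q n = (coprime_count q m + \sum_(m <= p < n) coprime p q)%N.
  by rewrite /coprime_count -big_cat_nat.
have := coprime_count_bound R m q_gt0; have := coprime_count_bound R n q_gt0.
rewrite E natrD !mulrBl !ler_norml => /andP[? ?] /andP[? ?].
by apply/andP; split; lra.
Qed.

(* Rounding the real endpoints costs at most 1 each, whence 4 q instead of 2 q. *)
Lemma coprime_count_real (R : realFieldType) (q K : nat) (P : pred nat)
    (alpha omega : R) :
  (0 < q)%N -> alpha <= omega ->
  (forall p : nat, P p = (alpha <= p%:R) && (p%:R <= omega)) ->
  (exists m, m%:R < alpha /\ alpha <= m.+1%:R) ->
  (exists n, [/\ n%:R <= omega, omega < n.+1%:R & (n <= K)%N]) ->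
  `|(\sum_(1 <= p < K.+1) (coprime p q && P p))%N%:R
    - (omega - alpha) * (totient q)%:R / q%:R| <= 4 * q%:R :> R.
Proof.
move=> q_gt0 le_ao PE [m [ma am]] [n [no on nK]].
have qR : (1 : R) <= q%:R by rewrite ler1n.
have mn : (m < n.+1)%N.
  by rewrite -(ltr_nat R); apply: lt_le_trans ma (le_trans le_ao (ltW on)).
have -> : (\sum_(1 <= p < K.+1) (coprime p q && P p))%N =
          (\sum_(m.+1 <= p < n.+1) coprime p q)%N.
  rewrite (big_cat_nat _ (n := m.+1)) //=; last by lia.
  rewrite [X in (X + _)%N]big_nat big1 ?add0n; last first.
    move=> p /andP[_ hp]; rewrite PE; case: lerP => [hap|]; rewrite ?andbF //.
    have hpm : p%:R <= m%:R :> R by rewrite ler_nat -ltnS.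
    by have := le_lt_trans (le_trans hap hpm) ma; rewrite ltxx.
  rewrite (big_cat_nat _ (n := n.+1)) //= [X in (_ + X)%N]big_nat.
  rewrite [X in (_ + X)%N]big1 ?addn0; last first.
    move=> p /andP[hp _]; rewrite PE.
    have : omega < p%:R by apply: lt_le_trans on _; rewrite ler_nat.
    by rewrite ltNge => /negbTE ->; rewrite !andbF.
  rewrite big_nat [RHS]big_nat; apply: eq_bigr => p /andP[hp1 hp2]; rewrite PE.
  have -> : p%:R <= omega by apply: le_trans no; rewrite ler_nat.
  have -> : alpha <= p%:R by apply: le_trans am _; rewrite ler_nat.
  by rewrite !andbT.
have h := coprime_count_interval R q_gt0 mn.
have : 0 <= ((totient q)%:R / q%:R : R) <= 1.
  rewrite divr_ge0 //= ler_pdivrMr ?(lt_le_trans ltr01) // mul1r ler_nat.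
  exact: totient_le.
move: h; rewrite -!mulrA; move: (_ / _) => r /[swap] /andP[r0 r1].
have d1 : `|(omega - alpha) - (n.+1%:R - m.+1%:R)| <= 2.
  by move: on no ma am; rewrite -!natr1 ler_norml => *; apply/andP; split; lra.
have d2 : `|((omega - alpha) - (n.+1%:R - m.+1%:R)) * r| <= 2.
  by rewrite normrM (ger0_norm r0) -[2]mulr1 ler_pM.
move: d2; rewrite mulrBl !ler_norml => /andP[? ?] /andP[? ?].
by apply/andP; split; lra.
Qed.

(* [(p', q')] is a primitive point of slope at least p/q in the triangle cut out
   by denominators at most N; in the coordinates of [cone_frac] below, these are
   the fractions between the centre a1/b1 and the fraction with coordinates
   [(p, q)]. *)
Definition in_cone (b1 b2 N p q p' q' : nat) : bool :=
  [&& coprime p' q', (p * q' <= p' * q)%N & (b1 * p' + b2 * q' <= N)%N].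

(** For fixed q' the two inequalities confine p' to the interval from p q' / q to L - b2 q' / b1.
    Its length is W q', negative exactly when the row is empty by W < 0, and integers coprime to q'
    have density phi(q') / q'. *)
Lemma in_cone_row (R : realType) (b1 b2 L p q q' : nat) :
  (0 < b1)%N -> (0 < q)%N -> (0 < q')%N -> (0 < p)%N ->
  let W : R := L%:R / q'%:R - (b1 * p + b2 * q)%:R / (b1 * q)%:R in
  let c := (\sum_(1 <= p' < L.+1) in_cone b1 b2 (b1 * L) p q p' q')%N in
  (0 <= W -> `|c%:R - W * (totient q')%:R| <= 4 * q'%:R) /\
  (W < 0 -> c = 0%N).
Proof.
move=> b1_gt0 q_gt0 q'_gt0 p_gt0 W c.
have b1R : (0 : R) < b1%:R by rewrite ltr0n.
have qR : (0 : R) < q%:R by rewrite ltr0n.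
have q'R : (0 : R) < q'%:R by rewrite ltr0n.
have pR : (0 : R) < p%:R by rewrite ltr0n.
pose alpha : R := p%:R * q'%:R / q%:R.
pose omega : R := L%:R - b2%:R * q'%:R / b1%:R.
have WE : W = (omega - alpha) / q'%:R.
  rewrite /W /omega /alpha !natrD !natrM; field.
  by rewrite !gt_eqF.
have PE p' : (p * q' <= p' * q)%N && (b1 * p' + b2 * q' <= b1 * L)%N =
    (alpha <= p'%:R) && (p'%:R <= omega).
  rewrite /alpha ler_pdivrMr // -!natrM ler_nat; congr (_ && _).
  rewrite /omega lerBrDr -(ler_pM2l b1R) mulrDr [b1%:R * (_ / _)]mulrC.
  by rewrite divfK ?gt_eqF // -!natrM -natrD ler_nat.
split=> [W_ge0|W_lt0]; last first.
  rewrite /c big1_seq // => p' _; rewrite /in_cone PE.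
  case: lerP => [h1|]; rewrite ?andbF //; case: lerP => [h2|]; rewrite ?andbF //.
  move: W_lt0; rewrite WE ltNge divr_ge0 // ?ler0n // subr_ge0.
  exact: le_trans h1 h2.
have le_ao : alpha <= omega.
  by move: W_ge0; rewrite WE pmulr_lge0 ?invr_gt0 // subr_ge0.
have a_gt0 : 0 < alpha by rewrite !mulr_gt0 ?invr_gt0.
have -> : W * (totient q')%:R = (omega - alpha) * (totient q')%:R / q'%:R.
  by rewrite WE mulrAC.
apply: (@coprime_count_real R q' L (fun p' => (p * q' <= p' * q)%N &&
  (b1 * p' + b2 * q' <= b1 * L)%N) alpha omega) => //.
(* The ceiling of [alpha] minus 1. The floor would not do, because [alpha] may be an integer and the
   lower inequality is strict. *)
- exists ((p * q').-1 %/ q)%N; split.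
    rewrite /alpha ltr_pdivlMr // -!natrM ltr_nat.
    have := leq_divM (p * q').-1 q; nia.
  rewrite /alpha ler_pdivrMr // -!natrM ler_nat.
  have := @ltn_ceil (p * q').-1 q q_gt0; nia.
- exists (Num.truncn omega); have o0 : 0 <= omega by apply: le_trans (ltW a_gt0) _.
  have /andP[h1 h2] := truncn_itv o0; split=> //.
  rewrite -(ler_nat R); apply: le_trans h1 _.
  by rewrite /omega gerBl !mulr_ge0 ?invr_ge0 ?ler0n.
Qed.

Definition cone_count (b1 b2 L i p q : nat) : nat :=
  \sum_(1 <= q' < i.+1) \sum_(1 <= p' < L.+1) in_cone b1 b2 (b1 * L) p q p' q'.

Definition totient_sum (n : nat) : nat := \sum_(1 <= k < n.+1) totient k.

Definition totient_ratio_sum (R : realType) (n : nat) : R :=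
  \sum_(1 <= k < n.+1) (totient k)%:R / k%:R.

(** The number t is chosen so that the row q' has W = L / q' - L / t: rows beyond t are empty, and
    the others add up to L (T(t) - S(t) / t). At most i rows remain, each with an error of at most 4
    i. *)
Lemma cone_count_approx (R : realType) (b1 b2 L i p q : nat) :
  (0 < b1)%N -> (0 < q)%N -> (0 < p)%N -> (0 < L)%N ->
  let t : R := (b1 * L * q)%:R / (b1 * p + b2 * q)%:R in
  t <= i%:R ->
  `|(cone_count b1 b2 L i p q)%:R
    - L%:R * (totient_ratio_sum R (Num.truncn t)
              - (totient_sum (Num.truncn t))%:R / t)| <= 4 * i%:R ^+ 2 :> R.
Proof.
move=> b1_gt0 q_gt0 p_gt0 L_gt0 t t_le.
have b1R : (0 : R) < b1%:R by rewrite ltr0n.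
have qR : (0 : R) < q%:R by rewrite ltr0n.
have LR : (0 : R) < L%:R by rewrite ltr0n.
have bR : (0 : R) < (b1 * p + b2 * q)%:R.
  by rewrite ltr0n addn_gt0 muln_gt0 b1_gt0 p_gt0.
have t_gt0 : 0 < t by rewrite divr_gt0 // !natrM !mulr_gt0.
have sE : (b1 * p + b2 * q)%:R / (b1 * q)%:R = L%:R / t :> R.
  rewrite /t !natrM; move: (_ + _)%N bR => b bR.
  by field; rewrite !gt_eqF.
have ti : (Num.truncn t <= i)%N.
  by rewrite -(ler_nat R); apply: le_trans (t_le); rewrite truncn_le ltW.
pose c q' := (\sum_(1 <= p' < L.+1) in_cone b1 b2 (b1 * L) p q p' q')%N.
have -> : cone_count b1 b2 L i p q = (\sum_(1 <= q' < (Num.truncn t).+1) c q')%N.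
  rewrite /cone_count (big_cat_nat _ (n := (Num.truncn t).+1)) //=.
  rewrite [X in (_ + X)%N]big_nat [X in (_ + X)%N]big1 ?addn0 //.
  move=> q' /andP[h1 h2].
  have q'_gt0 : (0 < q')%N by exact: leq_ltn_trans h1.
  have [_ ->] := in_cone_row R b2 L b1_gt0 q_gt0 q'_gt0 p_gt0 => //.
  have : t < q'%:R by rewrite -truncn_lt_nat // ltW.
  rewrite sE subr_lt0 => h.
  by rewrite ltr_pM2l // ltf_pV2 // posrE ?ltr0n.
rewrite /totient_ratio_sum /totient_sum !natr_sum mulr_suml -sumrB mulr_sumr -sumrB.
apply: le_trans (ler_norm_sum _ _ _) _.
apply: (@le_trans _ _ (\sum_(1 <= q' < (Num.truncn t).+1) (4 * i%:R))); last first.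
  rewrite sumr_const_nat subn1 -[leLHS]mulr_natr expr2 mulrA ler_wpM2l //.
  by rewrite ler_nat.
rewrite big_nat [leRHS]big_nat; apply: ler_sum => q' /andP[h1 h2].
have q'R : (0 : R) < q'%:R by rewrite ltr0n.
have [H _] := in_cone_row R b2 L b1_gt0 q_gt0 h1 p_gt0.
have -> : L%:R * ((totient q')%:R / q'%:R - (totient q')%:R / t) =
   (L%:R / q'%:R - (b1 * p + b2 * q)%:R / (b1 * q)%:R) * (totient q')%:R :> R.
  by rewrite sE; field; rewrite !gt_eqF.
apply: le_trans (H _) _.
  rewrite sE subr_ge0 ler_pM2l // lef_pV2 ?posrE //.
  by rewrite -truncn_ge_nat ?ltW // -ltnS.
by rewrite ler_wpM2l // ler_nat; apply: leq_trans ti; rewrite -ltnS.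
Qed.

(** * Summatory functions of the totient *)

Lemma delta_gt0 (R : realType) (A x : R) : 0 < delta A x.
Proof. exact: expR_gt0. Qed.

(** Valid for every x, even where the logarithms are not positive, since [powR] is never
    negative. *)
Lemma delta_le1 (R : realType) (A x : R) : 0 <= A -> delta A x <= 1.
Proof.
move=> A_ge0; rewrite /delta -[leRHS]expR0 ler_expR mulNr oppr_le0.
by rewrite mulr_ge0 // divr_ge0 // powR_ge0.
Qed.

Definition totient_defect (R : realType) (t : R) : R :=
  totient_ratio_sum R (Num.truncn t) - (totient_sum (Num.truncn t))%:R / t.

Lemma totient_ratio_sum_le (R : realType) (n : nat) :
  totient_ratio_sum R n <= n%:R.
Proof.
have -> : n%:R = \sum_(1 <= k < n.+1) (1 : R).
  by rewrite sumr_const_nat subn1.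
rewrite /totient_ratio_sum big_nat [leRHS]big_nat.
apply: ler_sum => k /andP[k_gt0 _].
by rewrite ler_pdivrMr ?ltr0n // mul1r ler_nat totient_le.
Qed.

(** A crude bound for the bounded range of t that precedes the threshold of the asymptotic
    estimate. *)
Lemma totient_defect_bounds (R : realType) (t : R) :
  1 <= t -> `|totient_defect t| <= 2 * t.
Proof.
move=> t1; have t0 : 0 < t by exact: lt_le_trans t1.
have h1 : (Num.truncn t)%:R <= t by rewrite truncn_le ltW.
have h2 := le_trans (totient_ratio_sum_le R (Num.truncn t)) h1.
have h3 : 0 <= totient_ratio_sum R (Num.truncn t).
  by apply: sumr_ge0 => k _; rewrite divr_ge0.
have h4 : (totient_sum (Num.truncn t))%:R / t <= t.
  rewrite ler_pdivrMr // /totient_sum natr_sum.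
  apply: (@le_trans _ _ (\sum_(1 <= k < (Num.truncn t).+1) t)).
    rewrite big_nat [leRHS]big_nat; apply: ler_sum => k /andP[_ hk].
    apply: le_trans h1; rewrite ler_nat.
    by apply: leq_trans (totient_le k) _; rewrite -ltnS.
  by rewrite sumr_const_nat subn1 -mulr_natl ler_wpM2r // ltW.
have h5 : 0 <= (totient_sum (Num.truncn t))%:R / t :> R.
  by rewrite divr_ge0 // ltW.
by rewrite /totient_defect ler_norml; apply/andP; split; lra.
Qed.

(** In E(t) - t H(t) the quadratic terms combine to c t^2, as 6/pi^2 = 2 c, and the whole equals -t
    (T(t) - S(t)/t - c t). The uniform bound by C serves the t below the cut-off, the sharper one
    those above it. *)
Lemma walfisz_totient_defect (R : realType) (A : R) : 0 <= A ->
  (fun x : R => totient_error x - x * totient_ratio_error x)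
     =O_ (pinfty_nbhs R) (fun x : R => x * delta A x) ->
  exists C X : R, [/\ 0 < C, 1 <= X,
    forall t, 1 <= t -> `|totient_defect t - 3 / pi ^+ 2 * t| <= C &
    forall t, X <= t -> `|totient_defect t - 3 / pi ^+ 2 * t| <= C * delta A t].
Proof.
move=> A_ge0 /eqO_exP[k k_gt0 [M [_ HM]]].
set c : R := 3 / pi ^+ 2.
have c_ge0 : 0 <= c by rewrite /c divr_ge0 // sqr_ge0.
pose X := Num.max 1 (M + 1).
have X1 : 1 <= X by rewrite /X le_max lexx.
have HX t : X <= t -> `|totient_defect t - c * t| <= k * delta A t.
  move=> Xt; have t_gt0 : 0 < t by apply: lt_le_trans Xt; apply: lt_le_trans X1.
  have Mt : M < t.
    apply: lt_le_trans Xt; rewrite /X lt_max; apply/orP; right; lra.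
  have E : totient_error t - t * totient_ratio_error t =
      - (t * (totient_defect t - c * t)).
    rewrite /totient_defect /totient_error /totient_ratio_error.
    rewrite /totient_ratio_sum /totient_sum natr_sum -/c.
    have -> : 6 / pi ^+ 2 = 2 * c :> R by rewrite /c mulrA; congr (_ / _); lra.
    by field; rewrite gt_eqF.
  have := HM t Mt; rewrite E normrN !normrM (gtr0_norm t_gt0).
  by rewrite (gtr0_norm (delta_gt0 _ _)) mulrCA ler_pM2l.
(* The summand (2 + c) X covers 1 <= t < X, where the crude bound gives (2 + c) t. *)
exists (k + (2 + c) * X), X; split=> //.
- by rewrite ltr_wpDr // mulr_ge0 ?addr_ge0 // (le_trans _ X1).
- move=> t t1; have [Xt|tX] := lerP X t.
    apply: le_trans (HX _ Xt) _; rewrite ler_wpDr //.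
      by rewrite mulr_ge0 ?addr_ge0 // (le_trans _ X1).
    by rewrite -[leRHS]mulr1 ler_wpM2l ?delta_le1 // ltW.
  apply: le_trans (ler_normB _ _) _; apply: (@le_trans _ _ ((2 + c) * t)).
    rewrite mulrDl lerD ?totient_defect_bounds // ger0_norm //.
    by rewrite mulr_ge0 // (le_trans _ t1).
  rewrite ler_wpDl //; first exact: ltW.
  by rewrite ler_wpM2l ?addr_ge0 // ltW.
- move=> t Xt; apply: le_trans (HX _ Xt) _; rewrite ler_wpM2r //.
    exact: ltW (delta_gt0 _ _).
  by rewrite lerDl mulr_ge0 ?addr_ge0 // (le_trans _ X1).
Qed.

(** For m < k <= n the quotient phi(k) / k lies between phi(k) / n and phi(k) / m; the boundary
    terms S(m) / m and S(n) / n then leave a single value of S. *)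
Lemma totient_defect_increment (R : realType) (m n : nat) :
  (0 < m)%N -> (m <= n)%N ->
  (totient_sum m)%:R * (m%:R^-1 - n%:R^-1)
    <= totient_defect n%:R - totient_defect m%:R :> R /\
  totient_defect n%:R - totient_defect m%:R
    <= (totient_sum n)%:R * (m%:R^-1 - n%:R^-1) :> R.
Proof.
move=> m_gt0 mn; rewrite /totient_defect !natrK.
have n_gt0 : (0 < n)%N by exact: leq_trans mn.
have E1 : totient_ratio_sum R n = totient_ratio_sum R m +
    \sum_(m.+1 <= k < n.+1) (totient k)%:R / k%:R.
  by rewrite /totient_ratio_sum -big_cat_nat.
have E2 : (totient_sum n)%:R = (totient_sum m)%:R +
    \sum_(m.+1 <= k < n.+1) (totient k)%:R :> R.
  by rewrite -natr_sum -natrD /totient_sum -big_cat_nat.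
have h1 : (\sum_(m.+1 <= k < n.+1) (totient k)%:R) / n%:R <=
    \sum_(m.+1 <= k < n.+1) (totient k)%:R / k%:R :> R.
  rewrite mulr_suml big_nat [leRHS]big_nat; apply: ler_sum => k /andP[h1 h2].
  rewrite ler_wpM2l // lef_pV2 ?posrE ?ltr0n ?ler_nat //; lia.
have h2 : \sum_(m.+1 <= k < n.+1) (totient k)%:R / k%:R <=
   (\sum_(m.+1 <= k < n.+1) (totient k)%:R) / m%:R :> R.
  rewrite mulr_suml big_nat [leRHS]big_nat; apply: ler_sum => k /andP[h3 h4].
  rewrite ler_wpM2l // lef_pV2 ?posrE ?ltr0n ?ler_nat //; lia.
by rewrite E1 E2 !mulrDl !mulrBr; split; lra.
Qed.

(* [totient_defect n] is [\int_1^n S(t)/t^2 dt] for the summatory function S of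
   the totient; monotonicity of S turns its linear asymptotics into S(n) ~ c n^2
   with a usable error term, without the value of zeta(2). *)
Lemma totient_sum_approx (R : realType) (C c : R) (n h : nat) :
  (forall t, 1 <= t -> `|totient_defect t - c * t| <= C) ->
  0 <= c -> 0 <= C -> (0 < h)%N -> (h < n)%N ->
  `|(totient_sum n)%:R - c * n%:R ^+ 2|
    <= c * n%:R * h%:R + 4 * C * (n%:R ^+ 2 / h%:R).
Proof.
move=> H c_ge0 C_ge0 h_gt0 hn.
have n_gt0 : (0 < n)%N by lia.
have hR : (0 : R) < h%:R by rewrite ltr0n.
have nR : (0 : R) < n%:R by rewrite ltr0n.
have hnR : h%:R < n%:R :> R by rewrite ltr_nat.
have nhR : (0 : R) < n%:R - h%:R by rewrite subr_gt0.
have H1 (k : nat) : (0 < k)%N -> `|totient_defect k%:R - c * k%:R| <= C.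
  by move=> k_gt0; apply: H; rewrite ler1n.
(* The window [n, n + h] bounds S(n) from above, the window [n - h, n] from below. A longer window
   dilutes the error C but moves the main term further. *)
have [] := totient_defect_increment R n_gt0 (leq_addr h n).
have := H1 n n_gt0; have := H1 (n + h)%N (ltn_addr _ n_gt0).
have := H1 (n - h)%N; rewrite subn_gt0 => /(_ hn).
have m_gt0 : (0 < n - h)%N by rewrite subn_gt0.
have [_] := totient_defect_increment R m_gt0 (leq_subr h n).
set Fm := totient_defect (n - h)%:R; set Fn := totient_defect n%:R.
set Fp := totient_defect (n + h)%:R; set S := (totient_sum n)%:R.
rewrite natrD natrB 1?ltnW // !ler_norml => b1 /andP[a1 a2] /andP[a3 a4].
move=> /andP[a5 a6] b2 _.
have E1 : n%:R^-1 - (n%:R + h%:R)^-1 = h%:R / (n%:R * (n%:R + h%:R)) :> R.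
  by field; rewrite !gt_eqF // addr_gt0.
have E2 : (n%:R - h%:R)^-1 - n%:R^-1 = h%:R / ((n%:R - h%:R) * n%:R) :> R.
  by field; rewrite !gt_eqF.
have U : S <= c * n%:R * (n%:R + h%:R) + 2 * C * (n%:R * (n%:R + h%:R)) / h%:R.
  have -> : c * n%:R * (n%:R + h%:R) + 2 * C * (n%:R * (n%:R + h%:R)) / h%:R =
    (c * h%:R + 2 * C) / (h%:R / (n%:R * (n%:R + h%:R))) :> R.
    by field; rewrite !gt_eqF // addr_gt0.
  rewrite ler_pdivlMr ?divr_gt0 ?mulr_gt0 ?addr_gt0 //.
  by rewrite -E1; apply: le_trans b2 _; lra.
have V : c * n%:R * (n%:R - h%:R) - 2 * C * (n%:R * (n%:R - h%:R)) / h%:R <= S.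
  have -> : c * n%:R * (n%:R - h%:R) - 2 * C * (n%:R * (n%:R - h%:R)) / h%:R =
    (c * h%:R - 2 * C) / (h%:R / ((n%:R - h%:R) * n%:R)) :> R.
    by field; rewrite !gt_eqF.
  rewrite ler_pdivrMr ?divr_gt0 ?mulr_gt0 //.
  by rewrite -E2; apply: le_trans b1; lra.
have E3 : 2 * C * (n%:R * (n%:R + h%:R)) / h%:R =
    2 * C * (n%:R ^+ 2 / h%:R) + 2 * C * n%:R.
  by field; rewrite !gt_eqF.
have E4 : 2 * C * (n%:R * (n%:R - h%:R)) / h%:R =
    2 * C * (n%:R ^+ 2 / h%:R) - 2 * C * n%:R.
  by field; rewrite !gt_eqF.
have E5 : C * n%:R <= C * (n%:R ^+ 2 / h%:R).
  by rewrite ler_wpM2l // expr2 -mulrA ler_peMr ?ltW // ltr_pdivlMr // mul1r.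
have E6 : 0 <= C * n%:R by rewrite mulr_ge0.
move: U V; rewrite E3 E4 => U V; apply/andP; split; lra.
Qed.

(** * The Farey sequence *)

Lemma mem_farey (N : nat) (x : rat) :
  reflect (exists a b : nat, [/\ (0 < b)%N, (b <= N)%N, (a <= b)%N, coprime a b
                               & x = a%:R / b%:R])
          (x \in farey N).
Proof.
rewrite /farey mem_sort; apply: (iffP allpairsPdep) => [[b [a [hb ha ->]]]|].
  move: hb ha; rewrite mem_iota mem_filter mem_iota => hb /andP[cab ha].
  by exists a, b; split=> //; lia.
move=> [a [b [b_gt0 bN ab cab ->]]]; exists b, a; split=> //.
  by rewrite mem_iota; lia.
by rewrite mem_filter cab mem_iota; lia.
Qed.

Lemma coprime_fraction_inj (a b a' b' : nat) :
  (0 < b)%N -> (0 < b')%N -> coprime a b -> coprime a' b' ->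
  a%:R / b%:R = a'%:R / b'%:R :> rat -> a = a' /\ b = b'.
Proof.
move=> b_gt0 b'_gt0 cab cab' /eqP.
rewrite eqr_div ?pnatr_eq0 -?lt0n // -!natrM eqr_nat => /eqP E.
have bb' : b = b'.
  apply/eqP; rewrite eqn_dvd; apply/andP; split.
    by rewrite -(@Gauss_dvdr b a) 1?coprime_sym // E dvdn_mull.
  by rewrite -(@Gauss_dvdr b' a') 1?coprime_sym // -E dvdn_mull.
split=> //; apply/eqP; rewrite -(eqn_pmul2r b_gt0) {2}bb' in E *.
by rewrite E bb'.
Qed.

Lemma farey_uniq (N : nat) : uniq (farey N).
Proof.
rewrite sort_uniq; apply: allpairs_uniq_dep; first exact: iota_uniq.
  by move=> b _; rewrite filter_uniq ?iota_uniq.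
move=> _ _ /allpairsPdep[b [a [hb ha ->]]] /allpairsPdep[b' [a' [hb' ha' ->]]] /=.
move: hb ha hb' ha'; rewrite !mem_iota !mem_filter => /andP[hb _] /andP[hab _].
move=> /andP[hb' _] /andP[hab' _] E.
by have [-> ->] := coprime_fraction_inj hb hb' hab hab' E.
Qed.

Lemma farey_sorted (N : nat) : sorted <%O (farey N).
Proof. by rewrite lt_sorted_uniq_le farey_uniq sort_le_sorted. Qed.

(** The successor accounts for b = 1, which contributes both 0/1 and 1/1; for b > 1 the numerator a
    = b is not coprime to b. *)
Lemma size_farey (N : nat) : (0 < N)%N -> size (farey N) = (totient_sum N).+1.
Proof.
have E b : (1 < b)%N ->
    size [seq a <- iota 0 b.+1 | coprime a b] = totient b.
  move=> b_gt1; rewrite size_filter -addn1 iotaD count_cat /= add0n.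
  rewrite addn0 /coprime gcdnn (gtn_eqF b_gt1) addn0 totient_count_coprime.
  rewrite -sum1_count /index_iota subn0 big_mkcond /=.
  by apply: eq_bigr => a _; rewrite coprime_sym /coprime; case: eqP.
case: N => // N _; rewrite size_sort size_allpairs_dep sumnE big_map.
rewrite /totient_sum /index_iota subSS subn0 [iota _ _]/=.
rewrite !big_cons -addSn; congr (_ + _)%N.
rewrite big_seq [RHS]big_seq; apply: eq_bigr => b.
by rewrite mem_iota => /andP[hb _]; apply: E.
Qed.

Lemma farey_pos_count (N : nat) (x : rat) :
  x \in farey N -> farey_pos N x = count (<= x) (farey N).
Proof.
move=> xF; rewrite -{2}(nth_index 0 xF) count_le_nth ?index_mem //.
exact: farey_sorted.
Qed.

Lemma farey_pos_le (N : nat) (x y : rat) : x \in farey N -> y \in farey N ->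
  (farey_pos N x <= farey_pos N y)%N = (x <= y).
Proof.
move=> xF yF; rewrite ltnS -(lt_sorted_leq_nth 0 (farey_sorted N)) ?inE ?index_mem //.
by rewrite !nth_index.
Qed.

Definition farey_discrepancy (R : realType) (N : nat) (x : rat) : R :=
  `|ratr x - (farey_pos N x)%:R / (size (farey N))%:R|.

(** Summation over elements instead of positions allows the later reindexing by cone coordinates, on
    either side of the centre. *)
Lemma partial_franel_sum (R : realType) (N : nat) (x y : rat) :
  x \in farey N -> y \in farey N ->
  partial_franel R N x y =
  \sum_(z <- farey N | Num.min x y <= z <= Num.max x y) farey_discrepancy R N z.
Proof.
move=> xF yF.
wlog xy : x y xF yF / x <= y.
  move=> H; have [xy|yx] := leP x y.
    by rewrite H // ?(min_idPl xy) ?(max_idPr xy).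
  rewrite /partial_franel minnC maxnC -/(partial_franel R N y x) H // 1?ltW //.
  by rewrite ?(min_idPl (ltW yx)) ?(max_idPr (ltW yx)).
have := xy; rewrite -(farey_pos_le xF yF) => pxy.
rewrite /partial_franel (minn_idPl pxy) (maxn_idPr pxy).
have yS : (index y (farey N) < size (farey N))%N by rewrite index_mem.
rewrite {1 2}/farey_pos big_add1 /= [RHS](big_nth 0) (min_idPl xy) (max_idPr xy).
rewrite [RHS]big_mkcond /= [RHS](big_cat_nat _ (n := index x (farey N))) //=; last first.
  by rewrite ltnW // index_mem.
rewrite [X in _ = X + _]big_nat [X in _ = X + _]big1 ?add0r; last first.
  move=> k /andP[_ kx]; case: ifP => // /andP[xk _].
  move: xk; rewrite -{1}(nth_index 0 xF) (lt_sorted_leq_nth 0 (farey_sorted N)).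
  - by rewrite leqNgt kx.
  - by rewrite inE index_mem.
  - by rewrite inE (ltn_trans kx) // index_mem.
rewrite [RHS](big_cat_nat _ (n := (index y (farey N)).+1)) //=; last first.
  exact: leqW.
rewrite [X in _ = _ + X]big_nat [X in _ = _ + X]big1 ?addr0; last first.
  move=> k /andP[yk kS]; case: ifP => // /andP[_].
  rewrite -{1}(nth_index 0 yF) (lt_sorted_leq_nth 0 (farey_sorted N)) ?inE //.
  by rewrite leqNgt yk.
rewrite big_nat [RHS]big_nat; apply: eq_bigr => k /andP[xk ky].
have kS : (k < size (farey N))%N by exact: leq_ltn_trans yS.
rewrite -{1}(nth_index 0 xF) -{1}(nth_index 0 yF).
rewrite !(lt_sorted_leq_nth 0 (farey_sorted N)) ?inE ?index_mem // xk -ltnS ky /=.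
by rewrite /franel_term /farey_discrepancy /farey_pos /farey_nth index_uniq ?farey_uniq.
Qed.

(** * Coordinates around a Farey fraction *)

Lemma count_disjoint (T : Type) (P Q1 Q2 : pred T) (s : seq T) :
  (forall z, P z = (Q1 z (+) Q2 z)) -> (forall z, ~~ (Q1 z && Q2 z)) ->
  count P s = (count Q1 s + count Q2 s)%N.
Proof.
move=> PE D; elim: s => //= z s ->; rewrite PE; have := D z.
by case: (Q1 z); case: (Q2 z) => //= _; lia.
Qed.

Lemma farey_pos_count_lt (N : nat) (x : rat) :
  x \in farey N -> farey_pos N x = (count (< x) (farey N)).+1.
Proof.
move=> xF; rewrite -{2}(nth_index 0 xF) count_lt_nth ?index_mem //.
exact: farey_sorted.
Qed.

Lemma count_le_iota (m n : nat) : count (fun q => q <= n)%N (iota 1 m) = minn m n.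
Proof.
elim: m => [|m IH]; first by rewrite min0n.
by rewrite -[in LHS](addn1 m) iotaD count_cat IH /= add1n addn0; lia.
Qed.

Section FareyCone.

Variables (a1 b1 a2 b2 L i M : nat) (e : int).

Let N : nat := (b1 * L)%N.
Let x : rat := a1%:R / b1%:R.

(* Since [a2 b1 - a1 b2] is 1 or -1, [(p, q)] are unimodular coordinates on the
   pairs (numerator, denominator), in which a1/b1 becomes [(1, 0)] and a2/b2
   becomes [(0, 1)]. *)
Definition cone_num (p q : nat) : nat := (a1 * p + a2 * q)%N.
Definition cone_den (p q : nat) : nat := (b1 * p + b2 * q)%N.
Definition cone_frac (p q : nat) : rat := (cone_num p q)%:R / (cone_den p q)%:R.

Let y : rat := cone_frac M 1.

Definition cone_points : seq (nat * nat) :=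
  [seq (p, q) | q <- iota 1 i, p <- [seq p <- iota 1 L | in_cone b1 b2 N M 1 p q]].

Lemma mem_cone_points (p q : nat) :
  ((p, q) \in cone_points) =
  [&& (0 < p)%N, (p <= L)%N, (0 < q)%N, (q <= i)%N & in_cone b1 b2 N M 1 p q].
Proof.
apply/allpairsPdep/idP => [[q' [p' [hq hp [-> ->]]]]|/and5P[h1 h2 h3 h4 h5]].
  move: hq hp; rewrite mem_filter !mem_iota => h1 /andP[-> h2].
  by rewrite andbT; lia.
by exists q, p; split; rewrite // ?mem_filter ?h5 /= mem_iota; lia.
Qed.

Lemma cone_points_uniq : uniq cone_points.
Proof.
apply: allpairs_uniq_dep; first exact: iota_uniq.
  by move=> q _; rewrite filter_uniq ?iota_uniq.
by move=> [q p] [q' p'] _ _ /= [-> ->].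
Qed.

Lemma sum_cone_points (R : realType) (f : nat -> R) :
  (forall q, 0 <= f q) ->
  \sum_(pq <- cone_points) f pq.2 <= L%:R * \sum_(q <- iota 1 i) f q.
Proof.
move=> f_ge0; rewrite big_allpairs_dep mulr_sumr.
apply: ler_sum => q _; rewrite big_filter /=.
apply: (@le_trans _ _ (\sum_(p <- iota 1 L) f q)).
  elim: (iota 1 L) => [|p s IH] /=; first by rewrite !big_nil.
  by rewrite !big_cons; case: ifP => _; rewrite ?lerD // ler_wpDl.
have -> : iota 1 L = index_iota 1 L.+1 by rewrite /index_iota subSS subn0.
by rewrite sumr_const_nat subn1 -[leLHS]mulr_natl.
Qed.

(** The sign [e] tells on which side of a1/b1 the cone lies; differences multiplied by [e] treat
    both sides at once. As (p, q) = (p - q)(1, 0) + q (1, 1) with q <= p, the bounds [a1_le] and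
    [a12_le] keep the fractions at most 1; unlike a2 <= b2, the latter also admits a2/b2 = 1/0. The
    value M = L / i makes the fraction with coordinates (M, 1) the far endpoint of the theorem. *)
Hypotheses (b1_gt0 : (0 < b1)%N) (det : (a2 * b1)%:Z - (a1 * b2)%:Z = e)
  (ee1 : e * e = 1) (a1_le : (a1 <= b1)%N) (a12_le : (a1 + a2 <= b1 + b2)%N)
  (b2_lt : (b2 < b1)%N) (LE : (M * i)%N = L) (i_gt1 : (1 < i)%N) (L_gt0 : (0 < L)%N).

Let M_gt0 : (0 < M)%N.
Proof. by move: L_gt0; rewrite -LE muln_gt0 => /andP[]. Qed.

(** The inverse of the unimodular coordinate change is again integral, so both pairs have the same
    common divisors. *)
Lemma coprime_cone (p q : nat) :
  coprime (cone_num p q) (cone_den p q) = coprime p q.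
Proof.
rewrite /coprime; congr (_ == _); apply/eqP; rewrite eqn_dvd; apply/andP; split.
  set g := gcdn _ _.
  have gn : (g%:Z %| (cone_num p q)%:Z)%Z by rewrite dvdzE dvdn_gcdl.
  have gd : (g%:Z %| (cone_den p q)%:Z)%Z by rewrite dvdzE dvdn_gcdr.
  have pE : p%:Z = e * (a2%:Z * (cone_den p q)%:Z - b2%:Z * (cone_num p q)%:Z).
    transitivity (e * e * p%:Z); first by rewrite ee1 mul1r.
    by rewrite -{2}det /cone_den /cone_num !PoszD !PoszM; ring.
  have qE : q%:Z = e * (b1%:Z * (cone_num p q)%:Z - a1%:Z * (cone_den p q)%:Z).
    transitivity (e * e * q%:Z); first by rewrite ee1 mul1r.
    by rewrite -{2}det /cone_den /cone_num !PoszD !PoszM; ring.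
  rewrite dvdn_gcd -[X in X && _]/(g%:Z %| p%:Z)%Z -[X in _ && X]/(g%:Z %| q%:Z)%Z.
  by rewrite pE qE !dvdz_mull // rpredB // dvdz_mull.
by rewrite dvdn_gcd !dvdn_add // dvdn_mull // ?dvdn_gcdl ?dvdn_gcdr.
Qed.

Lemma cone_den_gt0 (p q : nat) : (0 < p)%N -> (0 < cone_den p q)%N.
Proof. by move=> p0; rewrite /cone_den addn_gt0 muln_gt0 b1_gt0 p0. Qed.

Lemma cone_frac_sub (p q : nat) : (0 < p)%N ->
  e%:~R * (cone_frac p q - x) = q%:R / (b1%:R * (cone_den p q)%:R).
Proof.
move=> p_gt0; have d0 := cone_den_gt0 q p_gt0.
have b1R : b1%:R != 0 :> rat by rewrite pnatr_eq0 -lt0n.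
have dR : (cone_den p q)%:R != 0 :> rat by rewrite pnatr_eq0 -lt0n.
have eR : e%:~R * e%:~R = 1 :> rat by rewrite -intrM ee1.
have detR : e%:~R = a2%:R * b1%:R - a1%:R * b2%:R :> rat.
  by rewrite -det intrB -!pmulrn !natrM.
transitivity (e%:~R * e%:~R * q%:R / (b1%:R * (cone_den p q)%:R) : rat);
  last by rewrite eR mul1r.
rewrite /cone_frac /x {3}detR {1}/cone_num natrD !natrM.
have dE : (cone_den p q)%:R = b1%:R * p%:R + b2%:R * q%:R :> rat.
  by rewrite natrD !natrM.
by move: dR; rewrite dE => dR; field; rewrite dR b1R.
Qed.

(** The distance q / (b1 (b1 p + b2 q)) is an increasing function of q / p alone. *)
Lemma cone_frac_le (p q p' q' : nat) : (0 < p)%N -> (0 < p')%N ->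
  (e%:~R * (cone_frac p' q' - x) <= e%:~R * (cone_frac p q - x)) =
  (p * q' <= p' * q)%N.
Proof.
move=> p_gt0 p'_gt0; rewrite !cone_frac_sub //.
have d0 := cone_den_gt0 q p_gt0; have d0' := cone_den_gt0 q' p'_gt0.
rewrite ler_pdivrMr -?natrM ?ltr0n ?muln_gt0 ?b1_gt0 // mulrAC.
rewrite ler_pdivlMr ?ltr0n ?muln_gt0 ?b1_gt0 // -!natrM ler_nat.
rewrite /cone_den [LHS](_ : _ = (b1 * (b1 * (p * q') + b2 * (q * q'))
  <= b1 * (b1 * (p' * q) + b2 * (q * q')))%N); last by congr (_ <= _)%N; ring.
by rewrite leq_pmul2l // leq_add2r leq_pmul2l.
Qed.

Lemma cone_frac_inj :
  {in cone_points &, injective (fun pq => cone_frac pq.1 pq.2)}.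
Proof.
move=> [p q] [p' q']; rewrite !mem_cone_points => /and5P[p0 _ q0 _ /and3P[c _ _]].
move=> /and5P[p0' _ q0' _ /and3P[c' _ _]] /= E.
have h1 : (p * q' <= p' * q)%N by rewrite -cone_frac_le // E.
have h2 : (p' * q <= p * q')%N by rewrite -cone_frac_le // E.
have h : (p * q')%N = (p' * q)%N by apply/eqP; rewrite eqn_leq h1 h2.
have [|-> ->] // := @coprime_fraction_inj p q p' q' q0 q0' c c'.
by apply/eqP; rewrite eqr_div ?pnatr_eq0 -?lt0n // -!natrM h.
Qed.

Lemma cone_frac_farey (p q : nat) :
  (p, q) \in cone_points -> cone_frac p q \in farey N.
Proof.
rewrite mem_cone_points => /and5P[p0 _ q0 _ /and3P[c h1 h2]].
apply/mem_farey; exists (cone_num p q), (cone_den p q); split=> //.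
- exact: cone_den_gt0.
- rewrite /cone_num /cone_den; have : (q <= p)%N by nia.
  by move=> /subnK <-; rewrite !mulnDr -!addnA -!mulnDl leq_add // leq_mul.
- by rewrite coprime_cone.
Qed.

(** The denominator fits because b1 M + b2 <= 2 b1 M <= b1 M i = N, which takes b2 < b1 and i >
    1. *)
Lemma cone_point_extreme : (M, 1%N) \in cone_points.
Proof.
rewrite mem_cone_points M_gt0 /= /in_cone coprimen1 leqnn /= (ltnW i_gt1).
rewrite -LE leq_pmulr ?(ltnW i_gt1) //= /N -LE mulnA muln1.
apply: (@leq_trans (b1 * M * 2)); last by rewrite leq_mul2l i_gt1 orbT.
by rewrite muln2 -addnn leq_add2l; nia.
Qed.

Lemma cone_center_farey : x \in farey N.
Proof.
apply/mem_farey; exists a1, b1; split=> //.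
  by rewrite /N leq_pmulr.
have /esym := coprime_cone 1 0.
by rewrite /cone_num /cone_den !muln0 !muln1 !addn0 => <-.
Qed.

(** The point is surjectivity. Lying beyond the centre makes q positive, and lying within the
    endpoint gives M q <= p. Then b1 M q <= b1 p <= N = b1 M i bounds q by i and p by L. *)
Lemma farey_cone_perm :
  perm_eq [seq z <- farey N | 0 < e%:~R * (z - x) <= e%:~R * (y - x)]
          [seq cone_frac pq.1 pq.2 | pq <- cone_points].
Proof.
apply: uniq_perm; first by rewrite filter_uniq ?farey_uniq.
  by rewrite map_inj_in_uniq ?cone_points_uniq //; exact: cone_frac_inj.
move=> z; rewrite mem_filter; apply/idP/mapP; last first.
  move=> [[p q] hpq ->] /=; rewrite cone_frac_farey // andbT.
  move: hpq; rewrite mem_cone_points => /and5P[p0 _ q0 _ /and3P[_ h _]].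
  rewrite cone_frac_le // muln1 in h *; rewrite h andbT cone_frac_sub //.
  by rewrite divr_gt0 ?mulr_gt0 ?ltr0n // cone_den_gt0.
case/andP => /andP[z1 z2] /mem_farey[a [b [b_gt0 bN ab cab zE]]].
(* The inverse matrix applied to (a, b); signs are settled afterwards, hence integers. *)
pose p' : int := e * (a2%:Z * b%:Z - b2%:Z * a%:Z).
pose q' : int := e * (b1%:Z * a%:Z - a1%:Z * b%:Z).
have aE : a%:Z = a1%:Z * p' + a2%:Z * q'.
  transitivity (e * e * a%:Z); first by rewrite ee1 mul1r.
  by rewrite -{2}det /p' /q' !PoszM; ring.
have bE : b%:Z = b1%:Z * p' + b2%:Z * q'.
  transitivity (e * e * b%:Z); first by rewrite ee1 mul1r.
  by rewrite -{2}det /p' /q' !PoszM; ring.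
have b1R : (0 : rat) < b1%:R by rewrite ltr0n.
have bR : (0 : rat) < b%:R by rewrite ltr0n.
have zq : e%:~R * (z - x) = q'%:~R / (b1%:R * b%:R).
  rewrite zE /x /q' intrM intrB !intrM -!pmulrn; field.
  by rewrite !gt_eqF.
have bbR : (0 : rat) < b1%:R * b%:R by rewrite mulr_gt0.
have q'_gt0 : 0 < q'.
  by move: z1; rewrite zq pmulr_lgt0 ?invr_gt0 // ltr0z.
have hpq : M%:Z * q' <= p'.
  move: z2; rewrite zq /y cone_frac_sub // ler_pdivrMr // mul1r mulrC invfM mulrA.
  rewrite [b1%:R * b%:R]mulrC mulfK ?gt_eqF // ler_pdivlMr ?ltr0n ?cone_den_gt0 //.
  rewrite 2!pmulrn -intrM ler_int bE /cone_den muln1 PoszD PoszM => h.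
  by rewrite -(@ler_pM2l _ b1%:Z) //; lia.
case: (q') q'_gt0 hpq aE bE => // q q_gt0.
case: (p') => [p|p] hpq aE bE; last by move: hpq; nia.
have bE' : cone_den p q = b.
  by apply/eqP; rewrite -eqz_nat bE /cone_den PoszD !PoszM.
have aE' : cone_num p q = a.
  by apply/eqP; rewrite -eqz_nat aE /cone_num PoszD !PoszM.
have Mqp : (M * q <= p)%N by move: hpq; rewrite -PoszM lez_nat.
exists (p, q); last by rewrite zE /cone_frac /= aE' bE'.
rewrite mem_cone_points /in_cone muln1 Mqp -(coprime_cone p q) aE' bE' cab.
rewrite -/(cone_den p q) bE' bN !andbT.
have q0 : (0 < q)%N by lia.
have p0 : (0 < p)%N by apply: leq_trans Mqp; rewrite muln_gt0 M_gt0.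
rewrite p0 q0 /=; apply/andP; split.
  by rewrite -(leq_pmul2l b1_gt0); apply: leq_trans bN; rewrite -bE' leq_addr.
move: bN; rewrite -bE' /N /cone_den -LE => h.
have : (b1 * (M * q) <= b1 * (M * i))%N.
  by apply: leq_trans h; apply: leq_trans (leq_addr _ _); rewrite leq_pmul2l.
by rewrite leq_pmul2l // leq_pmul2l.
Qed.

Lemma count_cone (p q : nat) : (p, q) \in cone_points ->
  count (fun z => 0 < e%:~R * (z - x) <= e%:~R * (cone_frac p q - x)) (farey N)
  = cone_count b1 b2 L i p q.
Proof.
move=> hpq; have := hpq; rewrite mem_cone_points.
move=> /and5P[p0 _ q0 _ /and3P[_ h _]]; rewrite muln1 in h.
have hy : e%:~R * (cone_frac p q - x) <= e%:~R * (y - x).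
  by rewrite cone_frac_le // muln1.
pose P := fun z => e%:~R * (z - x) <= e%:~R * (cone_frac p q - x).
transitivity (count P [seq z <- farey N | 0 < e%:~R * (z - x) <= e%:~R * (y - x)]).
  rewrite count_filter; apply: eq_count => z /=; rewrite /P.
  apply/idP/idP => [/andP[-> h1]|/and3P[h1 h2 h3]]; last by rewrite h2 h1.
  by rewrite h1 /= (le_trans h1 hy).
rewrite (permP farey_cone_perm) count_map.
rewrite -sum1_count big_mkcond /cone_points big_allpairs_dep /cone_count.
rewrite /index_iota subSS subn0 big_seq [RHS]big_seq; apply: eq_bigr => q'.
rewrite mem_iota => /andP[q'0 _].
rewrite big_filter big_mkcond subSS subn0 big_seq [RHS]big_seq.
apply: eq_bigr => p'; rewrite mem_iota => /andP[p'0 _].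
have -> : preim (fun pq : nat * nat => cone_frac pq.1 pq.2) P (p', q') =
    (p * q' <= p' * q)%N by rewrite /= /P cone_frac_le.
rewrite /in_cone muln1.
(* The cone of (p, q) lies inside that of (M, 1), because M q <= p. *)
have : (p * q' <= p' * q)%N -> (M * q' <= p')%N by move=> ?; nia.
by case: coprime => //=; case: (p * q' <= p' * q)%N => [->//|_]; case: ifP.
Qed.

(** For e = 1 the elements counted fill (x, z], matching positions as counts of [<=]; for e = -1
    they fill [z, x), matching positions as counts of [<]. *)
Lemma farey_pos_cone (p q : nat) : (p, q) \in cone_points ->
  (farey_pos N (cone_frac p q))%:Z - (farey_pos N x)%:Z =
  e * (cone_count b1 b2 L i p q)%:Z.
Proof.
move=> hpq; have zF := cone_frac_farey hpq; have xF := cone_center_farey.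
have zx : 0 < e%:~R * (cone_frac p q - x).
  move: hpq; rewrite mem_cone_points => /and5P[p0 _ q0 _ _].
  by rewrite cone_frac_sub // divr_gt0 ?mulr_gt0 ?ltr0n // cone_den_gt0.
rewrite -count_cone //; move: (cone_frac p q) zF zx => z zF zx.
have [E|E] : e = 1 \/ e = -1 by move: ee1; nia.
  have -> : count (fun w => 0 < e%:~R * (w - x) <= e%:~R * (z - x)) (farey N) =
      count (fun w => x < w <= z) (farey N).
    by apply: eq_count => w; rewrite E !mul1r subr_gt0 lerD2r.
  move: zx; rewrite E !mul1r subr_gt0 => xz; rewrite !farey_pos_count //.
  rewrite (@count_disjoint _ (<= z) (<= x) (fun w => x < w <= z)).
  - by rewrite PoszD addrC addKr.
  - move=> w /=; case: (lerP w x) => [wx|//].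
    by rewrite (le_trans wx (ltW xz)).
  - by move=> w /=; case: (lerP w x).
have -> : count (fun w => 0 < e%:~R * (w - x) <= e%:~R * (z - x)) (farey N) =
    count (fun w => z <= w < x) (farey N).
  apply: eq_count => w.
  by rewrite E !mulN1r oppr_gt0 subr_lt0 lerN2 lerD2r andbC.
move: zx; rewrite E !mulN1r oppr_gt0 subr_lt0 => zx; rewrite !farey_pos_count_lt //.
rewrite (@count_disjoint _ (< x) (< z) (fun w => z <= w < x)).
- by rewrite [X in X - _]intS [X in _ - X]intS PoszD; ring.
- move=> w /=; case: (ltP w z) => [wz|//].
  by rewrite (lt_trans wz zx).
- by move=> w /=; case: ltP.
Qed.

Lemma partial_franel_cone (R : realType) :
  partial_franel R N x y = farey_discrepancy R N x
    + \sum_(pq <- cone_points) farey_discrepancy R N (cone_frac pq.1 pq.2).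
Proof.
have xF := cone_center_farey; have yF := cone_frac_farey cone_point_extreme.
have xy : 0 < e%:~R * (y - x).
  by rewrite cone_frac_sub // divr_gt0 ?mulr_gt0 ?ltr0n // cone_den_gt0.
rewrite partial_franel_sum // big_mkcond (bigD1_seq x) ?farey_uniq //=.
rewrite ge_min le_max lexx /=; congr (_ + _).
rewrite -big_mkcondr -big_filter.
rewrite [X in \big[_/_]_(_ <- X) _](_ : _ = [seq z <- farey N |
    0 < e%:~R * (z - x) <= e%:~R * (y - x)]); last first.
  apply: eq_filter => z /=; have [E|E] : e = 1 \/ e = -1 by move: ee1; nia.
    move: xy; rewrite E !mul1r !subr_gt0 lerD2r => xy.
    by rewrite (min_idPl (ltW xy)) (max_idPr (ltW xy)) lt_neqAle eq_sym andbA.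
  move: xy; rewrite E !mulN1r !oppr_gt0 !subr_lt0 lerN2 lerD2r => yx.
  rewrite (min_idPr (ltW yx)) (max_idPl (ltW yx)) lt_neqAle.
  by case: (z != x) => //=; rewrite andbC.
by rewrite (perm_big _ farey_cone_perm) big_map.
Qed.

(** Displacement and change of position both carry the factor [e], so it comes out of the difference
    and vanishes under the absolute value. *)
Lemma farey_discrepancy_cone (R : realType) (p q : nat) :
  (p, q) \in cone_points ->
  farey_discrepancy R N (cone_frac p q) <= farey_discrepancy R N x
    + `|q%:R / (b1%:R * (cone_den p q)%:R)
        - (cone_count b1 b2 L i p q)%:R / (size (farey N))%:R|.
Proof.
move=> hpq; have := farey_pos_cone hpq; have := hpq; rewrite mem_cone_points.
move=> /and5P[p0 _ _ _ _]; have := cone_frac_sub q p0.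
move=> /(congr1 (@ratr R)) + /(congr1 (fun z : int => z%:~R : R)).
rewrite /farey_discrepancy; set z := cone_frac p q; set k := cone_count _ _ _ _ _ _.
have -> : ratr (e%:~R * (z - x)) = e%:~R * (ratr z - ratr x) :> R.
  by rewrite rmorphM /= rmorphB /= ratr_int.
have -> : ratr (q%:R / (b1%:R * (cone_den p q)%:R)) =
    q%:R / (b1%:R * (cone_den p q)%:R) :> R.
  by rewrite fmorph_div /= rmorphM /= !ratr_nat.
rewrite intrB -!pmulrn.
rewrite intrM -pmulrn => E1 E2.
have eR : e%:~R * e%:~R = 1 :> R by rewrite -intrM ee1.
set s := (size _)%:R; set w := q%:R / _ in E1 *.
have -> : ratr z - (farey_pos N z)%:R / s =
    (ratr x - (farey_pos N x)%:R / s) + e%:~R * (w - k%:R / s).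
  rewrite -E1 mulrBr !mulrA eR mul1r -E2; ring.
apply: le_trans (ler_normD _ _) _; rewrite lerD2l normrM.
suff -> : `|e%:~R| = 1 :> R by rewrite mul1r.
have [->|->] : e = 1 \/ e = -1 by move: ee1; nia.
  by rewrite normr1.
by rewrite mulrN1z normrN1.
Qed.

End FareyCone.

(** * Error of a single term and summation over the cone *)

Lemma cone_term_bound (R : realType) (b1 b2 L M i p q : nat) (c s eta : R) :
  (0 < b1)%N -> (0 < L)%N -> (M * i)%N = L ->
  (0 < p)%N -> (0 < q)%N -> (M * q <= p)%N -> (b1 * p + b2 * q <= b1 * L)%N ->
  0 < s -> 0 <= eta ->
  `|s - c * (b1 * L)%:R ^+ 2| <= eta * (b1 * L)%:R ^+ 2 ->
  let t : R := (b1 * L * q)%:R / (b1 * p + b2 * q)%:R in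
  [/\ q%:R <= t, t <= i%:R &
  `|q%:R / (b1%:R * (b1 * p + b2 * q)%:R) - (cone_count b1 b2 L i p q)%:R / s|
    <= (L%:R * i%:R * eta + L%:R * `|totient_defect t - c * t| + 4 * i%:R ^+ 2) / s].
Proof.
move=> b1_gt0 L_gt0 LE p_gt0 q_gt0 Mqp pqN s_gt0 eta_ge0 hs t.
have b1R : (0 : R) < b1%:R by rewrite ltr0n.
have LR : (0 : R) < L%:R by rewrite ltr0n.
have qR : (0 : R) < q%:R by rewrite ltr0n.
have dR : (0 : R) < (b1 * p + b2 * q)%:R.
  by rewrite ltr0n addn_gt0 muln_gt0 b1_gt0 p_gt0.
have qt : q%:R <= t.
  by rewrite /t ler_pdivlMr // -natrM ler_nat mulnC leq_mul2r pqN orbT.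
have t_gt0 : 0 < t by exact: lt_le_trans qt.
have ti : t <= i%:R.
  rewrite /t ler_pdivrMr // -natrM ler_nat -LE.
  apply: (@leq_trans (b1 * p * i)); last by rewrite [leqRHS]mulnC leq_mul // leq_addr.
  have -> : (b1 * (M * i) * q = b1 * (M * q) * i)%N by ring.
  by rewrite leq_mul // leq_mul.
split=> //.
have K := @cone_count_approx R b1 b2 L i p q b1_gt0 q_gt0 p_gt0 L_gt0 ti.
rewrite -/t -/(totient_defect t) in K.
set k := (cone_count _ _ _ _ _ _)%:R in K *.
set n : R := (b1 * L)%:R in hs *.
have nR : 0 < n by rewrite /n natrM mulr_gt0.
have wE : q%:R / (b1%:R * (b1 * p + b2 * q)%:R) = L%:R * t / n ^+ 2.
  rewrite /t natrM -/n /n natrM; move: (b1 * p + b2 * q)%:R dR => d dR.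
  by field; rewrite !gt_eqF.
rewrite wE; clearbody t n => {wE}.
(* Three sources of error are separated: the size of F_N, the asymptotics of the totient defect, and
   the lattice point count. The main terms c L t cancel. *)
have -> : L%:R * t / n ^+ 2 - k / s =
   (L%:R * t / n ^+ 2 * (s - c * n ^+ 2) - L%:R * (totient_defect t - c * t)
    - (k - L%:R * totient_defect t)) / s.
  by field; rewrite !gt_eqF.
rewrite normrM [`|s^-1|]gtr0_norm ?invr_gt0 // ler_wpM2r ?invr_ge0 ?(ltW s_gt0) //.
apply: le_trans (ler_normB _ _) _; rewrite lerD //.
apply: le_trans (ler_normB _ _) _; rewrite lerD //; last first.
  by rewrite normrM gtr0_norm.
have w_gt0 : 0 < L%:R * t / n ^+ 2.
  by apply: divr_gt0; [exact: mulr_gt0 | exact: exprn_gt0].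
rewrite normrM gtr0_norm //.
apply: (@le_trans _ _ (L%:R * t / n ^+ 2 * (eta * n ^+ 2))).
  by rewrite ler_pM2l.
have -> : L%:R * t / n ^+ 2 * (eta * n ^+ 2) = L%:R * t * eta.
  by field; rewrite gt_eqF.
by rewrite ler_wpM2r // ler_pM2l.
Qed.

Lemma partial_franel_cone_le (R : realType) (a1 b1 a2 b2 L i M : nat) (e : int)
    (c C C1 d : R) :
  (0 < b1)%N -> (a2 * b1)%:Z - (a1 * b2)%:Z = e -> e * e = 1 ->
  (a1 <= b1)%N -> (a1 + a2 <= b1 + b2)%N -> (b2 < b1)%N ->
  (M * i)%N = L -> (1 < i)%N -> (i ^ 3 <= L)%N ->
  0 < c -> 0 <= C -> 0 <= C1 -> 0 <= d -> 1 <= i%:R * d ->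
  (forall t, 1 <= t -> `|totient_defect t - c * t| <= C) ->
  (forall t, i%:R * d <= t -> t <= i%:R -> `|totient_defect t - c * t| <= C * d) ->
  let N := (b1 * L)%N in
  let s : R := (size (farey N))%:R in
  `|s - c * N%:R ^+ 2| <= C1 / i%:R ^+ 2 * N%:R ^+ 2 ->
  c / 2 * N%:R ^+ 2 <= s ->
  partial_franel R N (a1%:R / b1%:R) (cone_frac a1 b1 a2 b2 M 1) <=
    farey_discrepancy R N (a1%:R / b1%:R) * (2 * (i%:R * N%:R))
    + 2 / c * (C1 + 2 * C + 4) * (i%:R * d).
Proof.
move=> b1_gt0 det ee1 a1_le a12_le b2_lt LE i_gt1 iL c_gt0 C_ge0 C1_ge0 d_ge0 id1.
move=> Hc Hf N s hs sN.
have L_gt0 : (0 < L)%N by apply: leq_trans iL; rewrite expn_gt0 (ltnW i_gt1).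
rewrite (partial_franel_cone b1_gt0 det ee1 a1_le a12_le b2_lt LE) //.
have N_gt0 : (0 < N)%N by rewrite muln_gt0 b1_gt0.
have NR : (0 : R) < N%:R by rewrite ltr0n.
have LR : (0 : R) < L%:R by rewrite ltr0n.
have iR : (0 : R) < i%:R by rewrite ltr0n ltnW.
have s_gt0 : 0 < s by apply: lt_le_trans sN; rewrite !mulr_gt0 ?exprn_gt0 ?invr_gt0.
pose eta : R := C1 / i%:R ^+ 2.
have eta_ge0 : 0 <= eta by rewrite divr_ge0 // sqr_ge0.
set X := farey_discrepancy R N (a1%:R / b1%:R).
have X_ge0 : 0 <= X by exact: normr_ge0.
(* A bound in terms of q alone: t below the cut-off i d forces q <= i d because q <= t. So C is paid
   by at most i d values of q, and C d by all i of them. *)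
pose f (q : nat) : R := X + (L%:R * i%:R * eta
  + L%:R * (C * (q <= Num.truncn (i%:R * d))%N%:R + C * d) + 4 * i%:R ^+ 2) / s.
have id0 : 0 <= i%:R * d by apply: le_trans id1.
have f_ge0 q : 0 <= f q.
  rewrite /f addr_ge0 // divr_ge0 ?(ltW s_gt0) // !addr_ge0 ?mulr_ge0 ?sqr_ge0 //.
  by rewrite addr_ge0 ?mulr_ge0.
have H1 : \sum_(pq <- cone_points b1 b2 L i M)
    farey_discrepancy R N (cone_frac a1 b1 a2 b2 pq.1 pq.2) <=
    L%:R * \sum_(q <- iota 1 i) f q.
  apply: le_trans (sum_cone_points _ _ _ _ _ f_ge0).
  rewrite big_seq [leRHS]big_seq; apply: ler_sum => -[p q] hpq /=.
  have := farey_discrepancy_cone b1_gt0 det ee1 a1_le a12_le b2_lt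
    LE i_gt1 L_gt0 R hpq.
  move=> /le_trans; apply.
  rewrite /f lerD2l; move: hpq; rewrite mem_cone_points.
  move=> /and5P[p0 _ q0 _ /and3P[_ Mqp pqN]]; rewrite muln1 in Mqp.
  have [qt ti H] := cone_term_bound b1_gt0 L_gt0 LE p0 q0 Mqp pqN s_gt0 eta_ge0 hs.
  apply: le_trans H _; rewrite ler_wpM2r ?invr_ge0 ?(ltW s_gt0) // lerD2r lerD2l.
  rewrite ler_pM2l //; move: qt ti; set t := _ / _ => qt ti.
  have [idt|tid] := lerP (i%:R * d) t.
    by apply: le_trans (Hf _ idt ti) _; rewrite ler_wpDl // mulr_ge0.
  rewrite truncn_ge_nat // (le_trans qt (ltW tid)) mulr1.
  apply: le_trans (Hc t _) _; first by apply: le_trans qt; rewrite ler1n.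
  by rewrite lerDl mulr_ge0.
have H2 : \sum_(q <- iota 1 i) f q <= i%:R * (X + (L%:R * i%:R * eta
    + L%:R * (2 * C * d) + 4 * i%:R ^+ 2) / s).
  pose n := Num.truncn (i%:R * d).
  have fE q : f q = (X + (L%:R * i%:R * eta + L%:R * (C * d) + 4 * i%:R ^+ 2) / s)
      + L%:R * C / s * (q <= n)%N%:R.
    by rewrite /f -/n; field; rewrite gt_eqF.
  have cE : (\sum_(q <- iota 1 i) (q <= n)%N)%N = minn i n.
    rewrite -count_le_iota -sum1_count [RHS]big_mkcond.
    by apply: eq_bigr => q _; case: leqP.
  under eq_bigr => q _ do rewrite fE.
  rewrite big_split /= -mulr_sumr -natr_sum cE.
  have -> : iota 1 i = index_iota 1 i.+1 by rewrite /index_iota subSS subn0.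
  rewrite sumr_const_nat subn1 -[X in X + _]mulr_natl /=.
  have hn : (minn i n)%:R <= i%:R * d.
    apply: (@le_trans _ _ n%:R); first by rewrite ler_nat geq_minr.
    by rewrite truncn_le.
  apply: (@le_trans _ _ (i%:R * (X + (L%:R * i%:R * eta + L%:R * (C * d)
      + 4 * i%:R ^+ 2) / s) + L%:R * C / s * (i%:R * d))).
    by rewrite lerD2l ler_wpM2l // divr_ge0 ?(ltW s_gt0) // mulr_ge0.
  by rewrite le_eqVlt; apply/orP; left; apply/eqP; field; rewrite gt_eqF.
(* With eta = C1 / i^2 the size error totals C1 L^2 / s; the counting error 4 L i^3 / s is of the
   same order as i^3 <= L. Finally L^2 / s <= 2 / c, and 1 <= i d absorbs the constants. *)
apply: (@le_trans _ _ (X + L%:R * (i%:R * (X + (L%:R * i%:R * eta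
    + L%:R * (2 * C * d) + 4 * i%:R ^+ 2) / s)))).
  by rewrite lerD2l; apply: le_trans H1 _; rewrite ler_pM2l.
have -> : X + L%:R * (i%:R * (X + (L%:R * i%:R * eta + L%:R * (2 * C * d)
    + 4 * i%:R ^+ 2) / s)) = X * (1 + i%:R * L%:R)
    + (L%:R ^+ 2 * C1 + L%:R ^+ 2 * (2 * C) * (i%:R * d)
       + 4 * L%:R * i%:R ^+ 3) / s.
  by rewrite /eta; field; rewrite !gt_eqF.
have LN : L%:R <= N%:R :> R by rewrite ler_nat leq_pmull.
rewrite lerD //.
  rewrite ler_wpM2l // mulr2n mulrDl mul1r lerD // ?ler_pM2l //.
  by rewrite -natrM ler1n muln_gt0 N_gt0 (ltnW i_gt1).
have i3 : i%:R ^+ 3 <= L%:R :> R by rewrite -natrX ler_nat.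
apply: (@le_trans _ _ ((C1 + 2 * C + 4) * (i%:R * d) * L%:R ^+ 2 / s)).
  rewrite ler_wpM2r ?invr_ge0 ?(ltW s_gt0) //.
  have h1 : L%:R * i%:R ^+ 3 <= L%:R ^+ 2 * (i%:R * d) :> R.
    rewrite expr2 -mulrA ler_pM2l //; apply: le_trans i3 _.
    by rewrite ler_peMr // ltW.
  have h2 : L%:R ^+ 2 * C1 <= L%:R ^+ 2 * C1 * (i%:R * d).
    by rewrite ler_peMr // mulr_ge0 // sqr_ge0.
  lra.
rewrite ler_pdivrMr //.
have h : L%:R ^+ 2 <= 2 / c * s.
  have : L%:R ^+ 2 <= N%:R ^+ 2 :> R by rewrite lerXn2r // nnegrE.
  move=> h; apply: le_trans h _.
  rewrite -(@ler_pM2l _ (c / 2)) ?divr_gt0 //; apply: le_trans sN _.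
  by rewrite le_eqVlt; apply/orP; left; apply/eqP; field; rewrite gt_eqF.
apply: (@le_trans _ _ ((C1 + 2 * C + 4) * (i%:R * d) * (2 / c * s))).
  by rewrite ler_wpM2l // mulr_ge0 // !addr_ge0 // mulr_ge0.
by rewrite le_eqVlt; apply/orP; left; apply/eqP; ring.
Qed.

(** * Growth of lcm(1..n) and of delta *)

Lemma lcm_uptoS (n : nat) : lcm_upto n.+1 = lcmn (lcm_upto n) n.+1.
Proof. by rewrite /lcm_upto big_nat_recr. Qed.

Lemma lcm_upto_gt0 (n : nat) : (0 < lcm_upto n)%N.
Proof.
elim: n => [|n IH]; first by rewrite /lcm_upto big_geq.
by rewrite lcm_uptoS lcmn_gt0 IH.
Qed.

Lemma lcm_upto_dvd (m n : nat) : (m <= n)%N -> (lcm_upto m %| lcm_upto n)%N.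
Proof.
move=> /subnKC <-; elim: (n - m)%N => [|k IH]; first by rewrite addn0.
by rewrite addnS lcm_uptoS (dvdn_trans IH) // dvdn_lcml.
Qed.

Lemma dvdn_lcm_upto (k n : nat) : (0 < k)%N -> (k <= n)%N -> (k %| lcm_upto n)%N.
Proof.
case: k => // k _ kn; apply: dvdn_trans (lcm_upto_dvd kn).
by rewrite lcm_uptoS dvdn_lcmr.
Qed.

(** Crude but sufficient: an extra factor log n in log N is absorbed by lowering the exponent
    constant of delta. *)
Lemma lcm_upto_le (n : nat) : (lcm_upto n <= n ^ n)%N.
Proof.
apply: (@leq_trans n`!).
  elim: n => [|n IH]; first by rewrite /lcm_upto big_geq.
  rewrite lcm_uptoS factS mulnC; apply: (@leq_trans (lcm_upto n * n.+1)).
    rewrite -muln_lcm_gcd leq_pmulr // gcdn_gt0 orbT //.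
  by rewrite leq_mul2r IH orbT.
suff H k : (n ^_ k <= n ^ k)%N by rewrite -ffactnn.
by elim: k => // k IH; rewrite ffactnSr expnSr leq_mul // leq_subr.
Qed.

(* The reciprocals 1/(m 'C(n, m)) form Leibniz' harmonic triangle: each is the
   difference of the entry above and its left neighbour. *)
Lemma leibniz_dvdn_lcm_upto (n m : nat) :
  (0 < m)%N -> (m <= n)%N -> (m * 'C(n, m) %| lcm_upto n)%N.
Proof.
elim: n m => [|n IH] m m_gt0 mn; first by move: m_gt0; rewrite ltnNge mn.
elim: m m_gt0 mn => // -[_ _ _|m IHm _ mn].
  by rewrite bin1 mul1n dvdn_lcm_upto.
have /dvdnP[x xE] := IHm isT (ltnW mn).
have /dvdnP[y yE] : (m.+1 * 'C(n, m.+1) %| lcm_upto n.+1)%N.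
  by apply: dvdn_trans (lcm_upto_dvd (leqnSn n)); rewrite IH.
set b := (m.+2 * _)%N; set a := (m.+1 * 'C(n.+1, m.+1))%N in xE.
set c := (m.+1 * 'C(n, m.+1))%N in yE.
have E1 : (b = (n - m) * 'C(n.+1, m.+1))%N by rewrite /b mul_bin_left subSS.
have E2 : (m.+1 * 'C(n, m.+1) = (n - m) * 'C(n, m))%N by rewrite mul_bin_left.
have E3 : (a = c + m.+1 * 'C(n, m))%N by rewrite /a /c -mulnDr binS.
(* The relation 1/b = 1/c - 1/a with denominators cleared; hence lcm / b is the difference y - x of
   two integers. *)
have E4 : (b * a = b * c + a * c)%N.
  rewrite E3 mulnDr; congr (_ + _)%N; rewrite E1 -E3 /a /c E2; ring.
have a_gt0 : (0 < a)%N by rewrite muln_gt0 bin_gt0; exact: ltnW.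
have c_gt0 : (0 < c)%N by rewrite muln_gt0 bin_gt0.
apply/dvdnP; exists (y - x)%N; apply/eqP.
rewrite -(eqn_pmul2r a_gt0) -(eqn_pmul2r c_gt0) !mulnBl; apply/eqP.
have -> : (y * b * a * c = b * a * lcm_upto n.+1)%N by rewrite yE; ring.
have -> : (x * b * a * c = b * c * lcm_upto n.+1)%N by rewrite xE; ring.
by rewrite -mulnBl E4 addKn -mulnA mulnC.
Qed.

(** In Vandermonde's sum of products C(m, j) C(m, m - j), dropping one positive factor from each
    leaves the expansion of (1 + 1)^m. *)
Lemma exp2_le_bin (m : nat) : (2 ^ m <= 'C(m + m, m))%N.
Proof.
rewrite -binomial.Vandermonde -[2%N]/(1 + 1)%N expnDn.
apply: leq_sum => j _; rewrite !exp1n !muln1 leq_pmulr // bin_gt0.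
exact: leq_subr.
Qed.

Lemma exp2_le_lcm_upto (n : nat) : (2 ^ n./2 <= lcm_upto n)%N.
Proof.
have h : (n./2 + n./2 <= n)%N by rewrite addnn -[leqRHS]odd_double_half leq_addl.
apply: leq_trans (dvdn_leq (lcm_upto_gt0 n) (lcm_upto_dvd h)).
apply: leq_trans (exp2_le_bin _) _; have [->|m_gt0] := posnP n./2.
  by rewrite /= bin0 lcm_upto_gt0.
apply: leq_trans (dvdn_leq (lcm_upto_gt0 _) (leibniz_dvdn_lcm_upto m_gt0 _)).
  by rewrite leq_pmull.
exact: leq_addr.
Qed.

Section DeltaGrowth.

Variable R : realType.
Implicit Types (A B x u w t : R) (n i : nat).

Lemma ln_le_linear (k : R) : 0 < k ->
  exists Y, forall y, Y <= y -> 0 < y -> ln y <= k * y.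
Proof.
move=> k0; exists (- ln (k / 2) / (k / 2)) => y.
have k2 : 0 < k / 2 by rewrite divr_gt0.
rewrite ler_pdivrMr // => h y0.
have := ln_sublinear (mulr_gt0 k2 y0); rewrite lnM ?posrE // => h'.
have -> : k * y = k / 2 * y + y * (k / 2) by field.
lra.
Qed.

Lemma ln_nat_unbounded (U : R) :
  exists n0, forall n, (n0 <= n)%N -> (1 < n)%N /\ U <= ln (n%:R : R).
Proof.
exists (maxn 2 (Num.truncn (expR U)).+1) => n; rewrite geq_max => /andP[n2 hn].
split=> //; rewrite -[U]expRK ler_ln ?posrE ?expR_gt0 ?ltr0n 1?ltnW //.
have /andP[_ h] := truncn_itv (expR_ge0 U).
by apply: ltW; apply: lt_le_trans h _; rewrite ler_nat.
Qed.

Definition walfisz_exponent (u : R) : R := u `^ (3 / 5) / ln u `^ (1 / 5).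

(** With th = A / B, the bound w <= th u costs th^(3/5) in the numerator, and u <= th w costs
    th^(1/5) in the logarithm; together th^(4/5) <= th. Monotonicity of the exponent is not
    invoked. *)
Lemma walfisz_exponent_compare A B : 0 < B -> B < A ->
  exists2 U, 1 < U & forall u w, 1 < u -> U <= w ->
    w <= A / B * u -> u <= A / B * w ->
    B * walfisz_exponent w <= A * walfisz_exponent u.
Proof.
move=> B_gt0 BA; set th := A / B.
have th1 : 1 < th by rewrite /th ltr_pdivlMr // mul1r.
have th0 : 0 < th by exact: lt_trans th1.
have AE : A = B * th by rewrite /th mulrC divfK // gt_eqF.
(* The second entry gives ln th <= (th - 1) ln w, whence ln u <= ln th + ln w <= th ln w. *)
clearbody th; exists (Num.max 2 (expR (ln th / (th - 1)))).
  by rewrite lt_max ltr1n.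
move=> u w u1; rewrite ge_max => /andP[w2 wU] wu uw.
have w1 : 1 < w by apply: lt_le_trans w2; rewrite ltr1n.
have u0 : 0 < u by exact: lt_trans u1.
have w0 : 0 < w by exact: lt_trans w1.
have lu0 : 0 < ln u by exact: ln_gt0.
have lw0 : 0 < ln w by exact: ln_gt0.
have luw : ln u <= th * ln w.
  have h1 : ln u <= ln th + ln w by rewrite -lnM ?posrE // ler_ln ?posrE ?mulr_gt0.
  have h2 : ln th <= (th - 1) * ln w.
    rewrite mulrC -ler_pdivrMr ?subr_gt0 //.
    by rewrite -(expRK (ln th / _)) ler_ln ?posrE ?expR_gt0.
  lra.
have p35 : 0 <= 3 / 5 :> R by rewrite divr_ge0.
have p15 : 0 <= 1 / 5 :> R by rewrite divr_ge0.
have h1 : w `^ (3 / 5) <= th `^ (3 / 5) * u `^ (3 / 5).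
  by rewrite -powRM ?(ltW th0) ?(ltW u0) // ge0_ler_powR ?nnegrE ?mulr_ge0 ?(ltW w0)
    ?(ltW u0) ?(ltW th0).
have h2 : ln u `^ (1 / 5) <= th `^ (1 / 5) * ln w `^ (1 / 5).
  by rewrite -powRM ?(ltW th0) ?(ltW lw0) // ge0_ler_powR ?nnegrE ?mulr_ge0 ?(ltW lw0)
    ?(ltW lu0) ?(ltW th0).
have h3 : th `^ (3 / 5) * th `^ (1 / 5) <= th.
  rewrite -powRD ?(gt_eqF th0) ?implybT // ler1_powR ?(ltW th1) //; lra.
have gu : 0 < ln u `^ (1 / 5) by rewrite powR_gt0.
have gw : 0 < ln w `^ (1 / 5) by rewrite powR_gt0.
have hu : 0 <= u `^ (3 / 5) by rewrite powR_ge0.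
have ht : 0 <= th `^ (3 / 5) by rewrite powR_ge0.
rewrite /walfisz_exponent.
rewrite AE -mulrA ler_pM2l // ler_pdivrMr //; apply: le_trans h1 _.
set W := ln w `^ (1 / 5) in gw h2 *; set V := ln u `^ (1 / 5) in gu h2 *.
set P := u `^ (3 / 5) in hu *; set T6 := th `^ (3 / 5) in ht h3 *.
set T2 := th `^ (1 / 5) in h2 h3 *.
clearbody W V P T6 T2; have hPV : 0 <= P / V by rewrite divr_ge0 // ltW.
apply: (@le_trans _ _ (T6 * (P / V) * (T2 * W))).
  have -> : T6 * P = T6 * (P / V) * V by field; rewrite gt_eqF.
  by rewrite ler_wpM2l // mulr_ge0.
have -> : T6 * (P / V) * (T2 * W) = T6 * T2 * (P / V * W) by ring.
by rewrite -[leRHS]mulrA ler_wpM2r // mulr_ge0 // ltW.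
Qed.

Lemma walfisz_exponent_sublinear (k : R) : 0 < k ->
  exists U, forall u, U <= u -> walfisz_exponent u <= k * u.
Proof.
(* From e on the logarithmic denominator is at least 1; from k^(-5/2) on, u^(3/5) <= k u. *)
move=> k0; exists (Num.max (expR 1) (k^-1 `^ (5 / 2))) => u.
rewrite ge_max => /andP[eu ku].
have u0 : 0 < u by apply: lt_le_trans eu; exact: expR_gt0.
have lu1 : 1 <= ln u by rewrite -[1]expRK ler_ln ?posrE ?expR_gt0.
have h1 : 1 <= ln u `^ (1 / 5).
  by have := @ler_powR R (ln u) lu1 0 (1 / 5); rewrite powRr0; apply; rewrite divr_ge0.
have h2 : k^-1 <= u `^ (2 / 5).
  have -> : k^-1 = (k^-1 `^ (5 / 2)) `^ (2 / 5).
    rewrite -powRrM (_ : 5 / 2 * (2 / 5) = 1) ?powRr1 ?invr_ge0 ?(ltW k0) //.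
    by field.
  by rewrite ge0_ler_powR ?nnegrE ?powR_ge0 ?(ltW u0) // divr_ge0.
apply: (@le_trans _ _ (u `^ (3 / 5))).
  by rewrite /walfisz_exponent ler_pdivrMr ?(lt_le_trans ltr01) // ler_peMr ?powR_ge0.
rewrite -(@ler_pM2l _ k^-1) ?invr_gt0 // mulKf ?gt_eqF //.
apply: (@le_trans _ _ (u `^ (2 / 5) * u `^ (3 / 5))).
  by rewrite ler_wpM2r ?powR_ge0.
rewrite -powRD ?(gt_eqF u0) ?implybT // (_ : 2 / 5 + 3 / 5 = 1) ?powRr1 ?(ltW u0) //.
by field.
Qed.

Lemma deltaE A x : delta A x = expR (- (A * walfisz_exponent (ln x))).
Proof. by rewrite /delta mulNr. Qed.

(* The cut-off [i * delta B i] is i^(1 - o(1)), so [delta A] is already below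
   [delta B i] from there on. *)
Lemma delta_cutoff A B (V : R) : 0 < B -> B < A ->
  exists n0, forall i, (n0 <= i)%N ->
    [/\ (1 < i)%N, V <= i%:R * delta B i%:R &
    forall t, i%:R * delta B i%:R <= t -> t <= i%:R ->
      delta A t <= delta B i%:R].
Proof.
move=> B_gt0 BA; have A_gt0 : 0 < A by exact: lt_trans BA.
have [U U1 HU] := walfisz_exponent_compare B_gt0 BA.
(* With this slope the logarithm of the cut-off is at least (B / A) u, where u = ln i. So ln t stays
   within the factor A / B of u that the comparison of exponents tolerates. *)
have k0 : 0 < (1 - B / A) / B.
  by rewrite divr_gt0 // subr_gt0 ltr_pdivrMr // mul1r.
have [U2 HU2] := walfisz_exponent_sublinear k0.
pose W := Num.max U (ln (Num.max 1 V)).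
have WU : U <= W by rewrite /W le_max lexx.
have WV : ln (Num.max 1 V) <= W by rewrite /W le_max lexx orbT.
have W0 : 0 < W by apply: lt_le_trans WU; apply: lt_trans U1.
have [n0 Hn0] := ln_nat_unbounded (Num.max U2 (A / B * W)).
exists n0 => i /Hn0[i1]; rewrite ge_max => /andP[iU2 iW].
have iR : (0 : R) < i%:R by rewrite ltr0n ltnW.
set u := ln (i%:R : R) in iU2 iW *.
have uE : i%:R = expR u by rewrite lnK ?posrE.
have BA0 : 0 < B / A by rewrite divr_gt0.
have h1 : B / A * u <= u - B * walfisz_exponent u.
  have : B * walfisz_exponent u <= (1 - B / A) * u.
    have -> : (1 - B / A) * u = B * ((1 - B / A) / B * u).
      by field; rewrite !gt_eqF.
    by rewrite ler_pM2l // HU2.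
  lra.
have h2 : W <= B / A * u.
  rewrite -(@ler_pM2l _ (A / B)) ?divr_gt0 //; apply: le_trans iW _.
  by rewrite le_eqVlt; apply/orP; left; apply/eqP; field; rewrite !gt_eqF.
have dE : i%:R * delta B i%:R = expR (u - B * walfisz_exponent u).
  by rewrite deltaE uE expRK expRD.
have WU1 : 1 < W by exact: lt_le_trans WU.
have u1 : 1 < u.
  have u0 : 0 < u by rewrite -(pmulr_rgt0 _ BA0) (lt_le_trans W0).
  apply: lt_le_trans WU1 _; apply: le_trans h2 _.
  by rewrite ler_piMl ?(ltW u0) // ler_pdivrMr // mul1r ltW.
split; first exact: i1.
- rewrite dE; apply: (@le_trans _ _ (Num.max 1 V)).
    by rewrite le_max lexx orbT.
  have m0 : 0 < Num.max 1 V by rewrite lt_max ltr01.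
  rewrite -[leLHS]lnK ?posrE // ler_expR; apply: le_trans WV _.
  exact: le_trans h2 h1.
- move=> t; rewrite dE => t1 ti.
  have t0 : 0 < t by apply: lt_le_trans t1; exact: expR_gt0.
  have lt1 : u - B * walfisz_exponent u <= ln t.
    by rewrite -[leLHS]expRK ler_ln ?posrE ?expR_gt0.
  have lt2 : ln t <= u by rewrite ler_ln ?posrE.
  have lt3 : B / A * u <= ln t by exact: le_trans lt1.
  have lt4 : W <= ln t by exact: le_trans lt3.
  rewrite !deltaE ler_expR lerN2 -/u; apply: HU.
  + exact: lt_le_trans lt4.
  + by apply: le_trans WU _; apply: le_trans h2 _; exact: le_trans lt3 lt2.
  + rewrite -(@ler_pM2l _ (B / A)) //; apply: le_trans lt3 _.
    by rewrite le_eqVlt; apply/orP; left; apply/eqP; field; rewrite !gt_eqF.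
  + apply: le_trans lt2 _; rewrite ler_peMl ?(ltW (lt_trans ltr01 u1)) //.
    by rewrite ler_pdivlMr // mul1r ltW.
Qed.

(** Serves to replace i by log N, which lies between constant multiples of i and i log i: then ln v
    = ln i + O(ln ln i), well within a factor A / B of ln i. *)
Lemma delta_le_of_nearly_linear A B (k : R) : 0 < B -> B < A -> 0 < k ->
  exists n0, forall i v, (n0 <= i)%N ->
    k * i%:R <= v -> v <= 2 * (i%:R * ln i%:R) -> delta A i%:R <= delta B v.
Proof.
move=> B_gt0 BA k_gt0; have A_gt0 : 0 < A by exact: lt_trans BA.
have [U U1 HU] := walfisz_exponent_compare B_gt0 BA.
set th := A / B in HU.
have th1 : 1 < th by rewrite /th ltr_pdivlMr // mul1r.
have th0 : 0 < th by exact: lt_trans th1.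
clearbody th.
have [Y HY] : exists Y, forall y, Y <= y -> 0 < y -> ln y <= (th - 1) / 2 * y.
  by apply: ln_le_linear; rewrite divr_gt0 // subr_gt0.
(* For u >= W and w = ln v: [Y] yields w <= th u, [U - ln k] yields U <= w, and the last entry
   yields u <= th (ln k + u) <= th w. *)
pose W := Num.max (Num.max 2 Y) (Num.max (U - ln k) (- (th * ln k) / (th - 1))).
have [n0 Hn0] := ln_nat_unbounded W.
exists n0 => i v /Hn0[i1]; rewrite !ge_max -!andbA => /and4P[u2 uY uU uth] v1 v2.
have iR : (0 : R) < i%:R by rewrite ltr0n ltnW.
set u := ln (i%:R : R) in u2 uY uU uth v2 *.
have u1 : 1 < u by apply: lt_le_trans u2; rewrite ltr1n.
have u0 : 0 < u by exact: lt_trans u1.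
have v0 : 0 < v by apply: lt_le_trans v1; rewrite mulr_gt0.
have w1 : ln k + u <= ln v by rewrite -lnM ?posrE // ler_ln ?posrE ?mulr_gt0.
have w2 : ln v <= ln (2 * u) + u.
  rewrite -lnM ?posrE ?mulr_gt0 // ler_ln ?posrE ?mulr_gt0 //.
  by apply: le_trans v2 _; rewrite le_eqVlt; apply/orP; left; apply/eqP; ring.
have w3 : ln (2 * u) <= (th - 1) * u.
  have -> : (th - 1) * u = (th - 1) / 2 * (2 * u) by field.
  apply: HY; last by rewrite mulr_gt0.
  by apply: le_trans uY _; rewrite ler_peMl ?(ltW u0) // ler1n.
have th10 : 0 < th - 1 by rewrite subr_gt0.
rewrite ler_pdivrMr // in uth.
rewrite !deltaE ler_expR lerN2 -/u; apply: HU => //.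
- by lra.
- by lra.
- have : th * (ln k + u) <= th * ln v by rewrite ler_pM2l.
  lra.
Qed.

(** The factor 1/4 stems from the rounded half of n being at least n / 4 for n > 1. *)
Lemma ln_lcm_upto_bounds n : (1 < n)%N ->
  ln 2 / 4 * n%:R <= ln (lcm_upto n)%:R :> R /\
  ln (lcm_upto n)%:R <= n%:R * ln n%:R :> R.
Proof.
move=> n1; have LR : (0 : R) < (lcm_upto n)%:R by rewrite ltr0n lcm_upto_gt0.
have ln2 : 0 < ln 2 :> R by apply: ln_gt0; rewrite ltr1n.
have nR : (0 : R) < n%:R by rewrite ltr0n ltnW.
split; last first.
  rewrite mulr_natl -lnXn // ler_ln ?posrE ?exprn_gt0 // -natrX ler_nat.
  exact: lcm_upto_le.
apply: (@le_trans _ _ (ln (2 ^ n./2)%:R)); last first.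
  by rewrite ler_ln ?posrE ?ltr0n ?expn_gt0 ?lcm_upto_gt0 // ler_nat exp2_le_lcm_upto.
rewrite natrX lnXn // -[leRHS]mulr_natr -mulrA ler_pM2l // mulrC ler_pdivrMr //.
by rewrite -natrM ler_nat; have := odd_double_half n; case: odd; lia.
Qed.

End DeltaGrowth.

(** * Partial Franel sums *)

Lemma partial_franel_ge0 (R : realType) (N : nat) (x y : rat) :
  0 <= partial_franel R N x y.
Proof. by apply: sumr_ge0 => n _; exact: normr_ge0. Qed.

Lemma farey_pos0 (N : nat) : (0 < N)%N -> 0 \in farey N /\ farey_pos N 0 = 1%N.
Proof.
move=> N_gt0; have F0 : 0 \in farey N.
  by apply/mem_farey; exists 0%N, 1%N; split; rewrite ?mul0r.
split=> //; rewrite farey_pos_count_lt //; congr _.+1; apply/eqP.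
rewrite -leqn0 leqNgt -has_count; apply/hasPn => z /mem_farey[a [b [_ _ _ _ ->]]].
by rewrite /= -leNgt divr_ge0.
Qed.

Lemma farey_reflect (N : nat) :
  perm_eq (farey N) [seq 1 - z | z <- farey N].
Proof.
have H z : z \in farey N -> 1 - z \in farey N.
  move=> /mem_farey[a [b [b0 bN ab cab ->]]]; apply/mem_farey.
  exists (b - a)%N, b; split=> //; first exact: leq_subr.
    suff E : gcdn (b - a) b = gcdn a b by rewrite /coprime E.
    by rewrite -{2}(subnK ab) gcdnDl gcdnC -{2}(subnK ab) gcdnDr.
  by rewrite natrB // mulrBl divff // pnatr_eq0 -lt0n.
apply: uniq_perm; rewrite ?farey_uniq // ?map_inj_uniq ?farey_uniq //.
  by move=> z w /= /addrI /oppr_inj.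
move=> z; apply/idP/mapP => [/H zF|[w /H wF ->] //].
by exists (1 - z) => //; ring.
Qed.

Lemma farey_discrepancy0 (R : realType) (N : nat) : (0 < N)%N ->
  farey_discrepancy R N 0 <= (size (farey N))%:R^-1.
Proof.
move=> N0; rewrite /farey_discrepancy (farey_pos0 N0).2 raddf0 sub0r normrN mul1r.
by rewrite ger0_norm ?invr_ge0.
Qed.

(** By reflection as many elements lie below 1/2 as above, say k. So |F_N| = 2 k + 1, the position
    of 1/2 is k + 1, and the discrepancy is exactly half of 1/|F_N|. *)
Lemma farey_discrepancy_half (R : realType) (N : nat) : (1 < N)%N ->
  farey_discrepancy R N (1 / 2) <= (size (farey N))%:R^-1.
Proof.
move=> N1; have hF : (1 / 2 : rat) \in farey N.
  by apply/mem_farey; exists 1%N, 2%N; split.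
pose k := count (< (1 / 2 : rat)) (farey N).
have k1 : count (<= (1 / 2 : rat)) (farey N) = k.+1.
  by rewrite -farey_pos_count // farey_pos_count_lt.
have k2 : count (predC (<= (1 / 2 : rat))) (farey N) = k.
  rewrite (permP (farey_reflect N)) count_map; apply: eq_count => z /=.
  by rewrite -ltNge; lra.
have sE : size (farey N) = (k.+1 + k)%N.
  by rewrite -(count_predC (<= (1 / 2 : rat))) k1 k2.
rewrite /farey_discrepancy farey_pos_count // k1 sE.
have -> : ratr (1 / 2) = 1 / 2 :> R by rewrite fmorph_div /= rmorph1 ratr_nat.
have kR : 0 <= k%:R :> R by [].
have -> : 1 / 2 - k.+1%:R / (k.+1 + k)%:R = - (2^-1 / (k.+1 + k)%:R) :> R.
  by rewrite natrD -[k.+1%:R]natr1; field; rewrite gt_eqF //; lra.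
rewrite normrN ger0_norm ?divr_ge0 //.
by rewrite -[leRHS]mul1r ler_wpM2r ?invr_ge0 //; lra.
Qed.

(** All constants precede the pair of fractions, which gives the uniformity in part (3). The lower
    bounds for |F_N| and i delta_B(i) are kept in the conclusion for absorbing the term of the
    centre in parts (1) and (2). *)
Lemma partial_franel_lcm_le (R : realType) (A B : R) :
  0 < A -> 0 < B -> B < A ->
  (fun x : R => totient_error x - x * totient_ratio_error x)
     =O_ (pinfty_nbhs R) (fun x : R => x * delta A x) ->
  exists (C c : R) (n0 : nat), [/\ 0 < C, 0 < c & forall i, (n0 <= i)%N ->
    [/\ (1 < i)%N, 1 <= i%:R * delta B i%:R &
    forall (a1 b1 a2 b2 : nat) (e : int),
      (0 < b1)%N -> (a2 * b1)%:Z - (a1 * b2)%:Z = e -> e * e = 1 ->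
      (a1 <= b1)%N -> (a1 + a2 <= b1 + b2)%N -> (b2 < b1)%N ->
      let N := (b1 * lcm_upto i)%N in
      c * N%:R ^+ 2 <= (size (farey N))%:R /\
      partial_franel R N (a1%:R / b1%:R)
          (cone_frac a1 b1 a2 b2 (lcm_upto i %/ i) 1) <=
        farey_discrepancy R N (a1%:R / b1%:R) * (C * (i%:R * N%:R))
        + C * (i%:R * delta B i%:R)]].
Proof.
move=> A_gt0 B_gt0 BA /(walfisz_totient_defect (ltW A_gt0)).
move=> [C0 [X [C0_gt0 X1 Hc Hf]]].
set c : R := 3 / pi ^+ 2 in Hc Hf.
have c_gt0 : 0 < c by rewrite divr_gt0 // exprn_gt0 // pi_gt0.
(* The summands pay for the extra element in |F_N| = S(N) + 1, for c N h and for 4 C0 N^2 / h, with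
   the window h = i^2. *)
clearbody c; pose C1 : R := 1 + c + 4 * C0.
have C1_gt0 : 0 < C1 by rewrite /C1; lra.
(* A cut-off beyond X makes the sharp estimate available above it; beyond 2 C1 / c it ensures C1 /
   i^2 <= c / 2, hence |F_N| >= c N^2 / 2. *)
have [n1 Hn1] := delta_cutoff (Num.max X (2 * C1 / c)) B_gt0 BA.
have ln2 : 0 < ln 2 / 4 :> R by rewrite divr_gt0 // ln_gt0 // ltr1n.
(* This slope gives 4 ln i <= (ln 2 / 4) i <= ln L, that is i^4 <= L. *)
have [|Y HY] := @ln_le_linear R (ln 2 / 4 / 4); first by rewrite divr_gt0.
pose C : R := 2 + 2 / c * (C1 + 2 * C0 + 4).
have C2 : 0 <= 2 / c * (C1 + 2 * C0 + 4).
  rewrite mulr_ge0 ?divr_ge0 ?(ltW c_gt0) //; lra.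
exists C, (c / 2), (maxn n1 (Num.truncn Y).+1); split.
- by rewrite /C; lra.
- by rewrite divr_gt0.
move=> i; rewrite geq_max => /andP[/Hn1[i1 iV Hd] iY].
move: iV; rewrite ge_max => /andP[iX iC].
set d := delta B i%:R in iX iC Hd *.
have d_gt0 : 0 < d by exact: delta_gt0.
have d1 : d <= 1 by apply: delta_le1; exact: ltW.
have iR : (0 : R) < i%:R by rewrite ltr0n ltnW.
have id1 : 1 <= i%:R * d by exact: le_trans iX.
split=> // a1 b1 a2 b2 e b1_gt0 det ee1 a1_le a12_le b2_lt N.
set L := lcm_upto i in N *.
have L_gt0 : (0 < L)%N by exact: lcm_upto_gt0.
have [lnL _] : _ /\ _ := ln_lcm_upto_bounds R i1; rewrite -/L in lnL.
have LE : (L %/ i * i)%N = L by rewrite divnK // dvdn_lcm_upto // ltnW.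
clearbody L d.
have iL4 : (i ^ 4 <= L)%N.
  have Yi : Y <= i%:R.
    apply: ltW; apply: lt_le_trans (truncnS_gt Y) _.
    by rewrite ler_nat.
  have h : ln (i%:R ^+ 4 : R) <= ln L%:R.
    rewrite lnXn //; apply: le_trans lnL.
    by have := HY i%:R Yi iR; rewrite -[ln i%:R *+ 4]mulr_natr; lra.
  by rewrite -(ler_nat R) natrX -ler_ln // posrE ?exprn_gt0 // ltr0n.
have N_gt0 : (0 < N)%N by rewrite muln_gt0 b1_gt0.
have iN4 : (i ^ 4 <= N)%N by apply: leq_trans iL4 _; rewrite leq_pmull.
have NR : (0 : R) < N%:R by rewrite ltr0n.
have hs : `|(size (farey N))%:R - c * N%:R ^+ 2| <= C1 / i%:R ^+ 2 * N%:R ^+ 2.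
  (* The window i^2 makes the errors N i^2 and N^2 / i^2; the first is the smaller since i^4 <=
     N. *)
  have hN : (i ^ 2 < N)%N by apply: leq_trans iN4; rewrite ltn_exp2l.
  have := totient_sum_approx Hc (ltW c_gt0) (ltW C0_gt0) _ hN.
  rewrite expn_gt0 (ltnW i1) size_farey // -natr1 natrX => /(_ isT).
  set S := (totient_sum N)%:R; set Q := N%:R ^+ 2 / i%:R ^+ 2 => h.
  have h2 : N%:R * i%:R ^+ 2 <= Q.
    rewrite /Q ler_pdivlMr ?exprn_gt0 // -mulrA -exprD expr2 ler_pM2l //.
    by rewrite -natrX ler_nat.
  have h3 : 1 <= Q.
    by apply: le_trans h2; rewrite -natrX -natrM ler1n muln_gt0 N_gt0 expn_gt0 ltnW.
  have -> : C1 / i%:R ^+ 2 * N%:R ^+ 2 = C1 * Q by rewrite /Q; ring.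
  have h4 : c * (N%:R * i%:R ^+ 2) <= c * Q by rewrite ler_pM2l.
  move: h; rewrite !ler_norml => /andP[? ?]; rewrite /C1; apply/andP; split; lra.
have sN : c / 2 * N%:R ^+ 2 <= (size (farey N))%:R.
  have h : C1 / i%:R ^+ 2 <= c / 2.
    rewrite ler_pdivrMr ?exprn_gt0 //.
    have : 2 * C1 / c <= i%:R ^+ 2.
      apply: le_trans iC _; rewrite expr2 ler_pM2l //; apply: le_trans d1 _.
      by rewrite ler1n ltnW.
    by rewrite ler_pdivrMr //; lra.
  have h2 : C1 / i%:R ^+ 2 * N%:R ^+ 2 <= c / 2 * N%:R ^+ 2.
    by rewrite ler_wpM2r // sqr_ge0.
  by move: hs; rewrite ler_norml => /andP[h3 _]; lra.
split=> //.
have iL3 : (i ^ 3 <= L)%N.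
  by apply: leq_trans iL4; rewrite leq_exp2l.
have Hf' t : i%:R * d <= t -> t <= i%:R -> `|totient_defect t - c * t| <= C0 * d.
  move=> t1 t2; apply: le_trans (Hf _ (le_trans iX t1)) _.
  by rewrite ler_pM2l // Hd.
apply: le_trans (partial_franel_cone_le b1_gt0 det ee1 a1_le a12_le b2_lt LE i1 iL3
  c_gt0 (ltW C0_gt0) (ltW C1_gt0) (ltW d_gt0) id1 Hc Hf' hs sN) _.
rewrite lerD //.
  rewrite ler_wpM2l ?normr_ge0 // ler_pM2r ?mulr_gt0 //.
  by rewrite /C; lra.
rewrite ler_pM2r ?mulr_gt0 //.
by rewrite /C; lra.
Qed.

Lemma partial_franel_lcm_ln_le (R : realType) (A B : R) :
  0 < A -> 0 < B -> B < A ->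
  (fun x : R => totient_error x - x * totient_ratio_error x)
     =O_ (pinfty_nbhs R) (fun x : R => x * delta A x) ->
  exists (C : R) (n0 : nat), 0 < C /\ forall i, (n0 <= i)%N -> (1 < i)%N /\
    forall (a1 b1 a2 b2 : nat) (e : int),
      (0 < b1)%N -> (a2 * b1)%:Z - (a1 * b2)%:Z = e -> e * e = 1 ->
      (a1 <= b1)%N -> (a1 + a2 <= b1 + b2)%N -> (b2 < b1)%N -> (b1 <= 2)%N ->
      let N := (b1 * lcm_upto i)%N in
      farey_discrepancy R N (a1%:R / b1%:R) <= (size (farey N))%:R^-1 ->
      partial_franel R N (a1%:R / b1%:R)
          (cone_frac a1 b1 a2 b2 (lcm_upto i %/ i) 1) <=
        C * (ln N%:R * delta B (ln N%:R)).
Proof.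
move=> A_gt0 B_gt0 BA W.
(* The gap from A to B' is spent on the cut-off, the one from B' to B on passing from i to log N. *)
have [B' [BB' B'A]] : exists B', B < B' /\ B' < A by exists ((A + B) / 2); split; lra.
have B'_gt0 : 0 < B' by exact: lt_trans BB'.
have [C [c [n1 [C_gt0 c_gt0 H]]]] := partial_franel_lcm_le A_gt0 B'_gt0 B'A W.
have k_gt0 : 0 < ln 2 / 4 :> R by rewrite divr_gt0 // ln_gt0 // ltr1n.
have [n2 Hn2] := delta_le_of_nearly_linear B_gt0 BB' k_gt0.
pose k : R := ln 2 / 4; have kE : k = ln 2 / 4 by [].
rewrite -kE in k_gt0 Hn2.
exists ((C / c + C) / k), (maxn n1 n2); split.
  by rewrite divr_gt0 // addr_gt0 // divr_gt0.
move=> i; rewrite geq_max => /andP[/H[i1 id1 {}H] i2]; split=> //.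
move=> a1 b1 a2 b2 e b1_gt0 det ee1 a1_le a12_le b2_lt b1_le N hx.
have iR : (0 : R) < i%:R by rewrite ltr0n ltnW.
have L_gt0 := lcm_upto_gt0 i.
have [lnL lnU] := ln_lcm_upto_bounds R i1; rewrite -kE in lnL.
have iL : (i <= lcm_upto i)%N by rewrite dvdn_leq // dvdn_lcm_upto // ltnW.
have [] := H a1 b1 a2 b2 e b1_gt0 det ee1 a1_le a12_le b2_lt.
rewrite -/N; set P := partial_franel _ _ _ _; set X := farey_discrepancy _ _ _ in hx *.
have X_ge0 : 0 <= X by exact: normr_ge0.
set s := (size _)%:R in hx * => sN HP.
have LN : (lcm_upto i <= N)%N by rewrite leq_pmull.
have NL : (N <= 2 * lcm_upto i)%N by rewrite leq_mul2r b1_le orbT.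
clearbody k N P X s; move: (lcm_upto i) L_gt0 lnL lnU iL LN NL.
move=> L L_gt0 lnL lnU iL LN NL.
have LR : (0 : R) < L%:R by rewrite ltr0n.
have NR : (0 : R) < N%:R by rewrite ltr0n (leq_trans L_gt0).
have i1R : (1 : R) < i%:R by rewrite ltr1n.
have lnN1 : k * i%:R <= ln N%:R :> R.
  by apply: le_trans lnL _; rewrite ler_ln ?posrE // ler_nat.
have lnN2 : ln N%:R <= 2 * (i%:R * ln i%:R) :> R.
  have h1 : ln N%:R <= ln 2 + ln L%:R :> R.
    by rewrite -lnM ?posrE // ler_ln ?posrE ?mulr_gt0 // -natrM ler_nat.
  have h2 : ln 2 <= ln i%:R :> R by rewrite ler_ln ?posrE // ler_nat.
  have h3 : ln i%:R <= i%:R * ln i%:R :> R.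
    by rewrite ler_peMl ?ln_ge0 // ltW.
  lra.
have hd := Hn2 i _ i2 lnN1 lnN2.
set d := delta B' i%:R in hd id1 HP.
have d_gt0 : 0 < d by exact: delta_gt0.
set D := delta B _ in hd *; clearbody d D.
have s_gt0 : 0 < s by apply: lt_le_trans sN; rewrite mulr_gt0 // exprn_gt0.
(* The centre contributes at most C i N / (c N^2), and i <= N; this constant is absorbed by 1 <= i
   d. *)
have h1 : X * (C * (i%:R * N%:R)) <= C / c * (i%:R * d).
  apply: (@le_trans _ _ (C / c)); last by rewrite ler_peMr // divr_ge0 // ltW.
  apply: (@le_trans _ _ ((c * N%:R ^+ 2)^-1 * (C * (N%:R * N%:R)))).
    apply: ler_pM => //; first by rewrite !mulr_ge0 // ltW.
      apply: le_trans hx _; rewrite lef_pV2 ?posrE // mulr_gt0 // exprn_gt0 //.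
    by rewrite ler_pM2l // ler_pM2r // ler_nat (leq_trans iL).
  by rewrite le_eqVlt; apply/orP; left; apply/eqP; field; rewrite !gt_eqF.
apply: (@le_trans _ _ ((C / c + C) * (i%:R * d))).
  by apply: le_trans HP _; rewrite mulrDl lerD2r.
have h2 : i%:R * d <= k^-1 * (ln N%:R * D).
  rewrite ler_pdivlMl // mulrA; apply: ler_pM => //; last exact: ltW.
  by rewrite mulr_ge0 // ltW.
by rewrite -mulrA ler_pM2l // addr_gt0 // divr_gt0.
Qed.

Theorem theorem3p5 (R : realType) (A B : R)
    (A_gt0 : 0 < A)
    (walfisz : (fun x : R => totient_error x - x * totient_ratio_error x)
                 =O_ (pinfty_nbhs R) (fun x : R => x * delta A x))
    (B_gt0 : 0 < B) (B_ltA : B < A) :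
  (let N i := lcm_upto i in
   let x i : rat := ((N i)%:R / i%:R)^-1 in
   (forall i : nat, (0 < i)%N ->
      partial_franel R (N i) 0 (x i) =
      \sum_(1 <= j < (farey_pos (N i) (x i)).+1) franel_term R (N i) j) /\
   (fun i : nat => partial_franel R (N i) 0 (x i)) =O_ \oo
     (fun i : nat => ln (N i)%:R * delta B (ln (N i)%:R)))
  /\
  (let N i := (2 * lcm_upto i)%N in
   let x i : rat := ((N i)%:R / (2 * i%:R)) / ((N i)%:R / i%:R + 1) in
   let y i : rat := ((N i)%:R / (2 * i%:R) + 1) / ((N i)%:R / i%:R + 1) in
   (fun i : nat => partial_franel R (N i) (1 / 2) (x i)) =O_ \oo
     (fun i : nat => ln (N i)%:R * delta B (ln (N i)%:R)) /\
   (fun i : nat => partial_franel R (N i) (1 / 2) (y i)) =O_ \oo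
     (fun i : nat => ln (N i)%:R * delta B (ln (N i)%:R)))
  /\
  (exists C : R, \forall i \near \oo,
     forall a1 b1 a2 b2 : nat,
       farey_pair (a1, b1) (a2, b2) -> (2 < b1)%N -> (b2 < b1)%N ->
       let N := (b1 * lcm_upto i)%N in
       let M : rat := N%:R / (b1%:R * i%:R) in
       let x : rat := a1%:R / b1%:R in
       let y : rat := (a1%:R * M + a2%:R) / (b1%:R * M + b2%:R) in
       partial_franel R N x y <=
         `|ratr x - (farey_pos N x)%:R / (size (farey N))%:R|
           * (C * (i%:R * N%:R))
         + C * (i%:R * delta B i%:R)).
Proof.
have [C [n1 [C_gt0 H12]]] := partial_franel_lcm_ln_le A_gt0 B_gt0 B_ltA walfisz.
have [K [c [n2 [K_gt0 _ H3]]]] := partial_franel_lcm_le A_gt0 B_gt0 B_ltA walfisz.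
have near_bigO (f g : nat -> R) :
    (forall i, (n1 <= i)%N -> 0 <= f i /\ f i <= C * g i) -> f =O_ \oo g.
  move=> fg; apply/eqO_exP; exists C => //; exists n1 => // i /= /fg[f_ge0 f_le].
  by rewrite (ger0_norm f_ge0); apply: le_trans f_le _; rewrite ler_pM2l // ler_norm.
have ratioE (i b : nat) : (1 < i)%N -> (0 < b)%N ->
    (b * lcm_upto i)%:R / (b%:R * i%:R) = (lcm_upto i %/ i)%:R :> rat.
  move=> i1 b0; have i0 : (0 < i)%N by exact: ltnW.
  rewrite -{1}(divnK (dvdn_lcm_upto i0 (leqnn i))) !natrM; field.
  by rewrite !pnatr_eq0 -!lt0n i0 b0.
have halfE (N i : nat) : N%:R / i%:R = 2 * (N%:R / (2 * i%:R)) :> rat.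
  by rewrite invfM mulrA mulrCA mulrA mulrA divff ?mul1r.
split; last split.
- split=> [i i_gt0|].
    rewrite /partial_franel (farey_pos0 (lcm_upto_gt0 i)).2.
    by rewrite (minn_idPl _) ?(maxn_idPr _).
  apply: near_bigO => i /H12[i1 {}H12]; split; first exact: partial_franel_ge0.
  (* The pair 0/1, 1/0 gives the cone fraction 1 / M with M = N / i. *)
  have := H12 0%N 1%N 1%N 0%N 1 isT erefl erefl isT isT isT isT.
  rewrite mul1n !mul0r => /(_ (farey_discrepancy0 _ (lcm_upto_gt0 i))).
  rewrite /cone_frac /cone_num /cone_den !mul0n !mul1n !addn0 add0n div1r.
  by rewrite -(ratioE i 1%N) // !mul1n mul1r.
- have half (i : nat) : (1 < 2 * lcm_upto i)%N by have := lcm_upto_gt0 i; lia.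
  split; apply: near_bigO => i hi; have [i1 H] := H12 i hi;
    (split; first exact: partial_franel_ge0).
  (* The neighbour 0/1 puts the cone to the left of 1/2, hence the sign -1; 1/1 below puts it to the
     right. *)
  + have := H 1%N 2%N 0%N 1%N (-1) isT erefl erefl isT isT isT isT.
    move=> /(_ (farey_discrepancy_half _ (half i))).
    rewrite /cone_frac /cone_num /cone_den !mul1n mul0n addn0.
    by rewrite (halfE (2 * lcm_upto i)%N i) ratioE // natrD [(2 * (_ %/ _))%:R]natrM.
  + have := H 1%N 2%N 1%N 1%N 1 isT erefl erefl isT isT isT isT.
    move=> /(_ (farey_discrepancy_half _ (half i))).
    rewrite /cone_frac /cone_num /cone_den !mul1n.
    by rewrite (halfE (2 * lcm_upto i)%N i) ratioE // [(_ %/ _ + 1)%:R]natrD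
      [(2 * _ + 1)%:R]natrD [(2 * (_ %/ _))%:R]natrM.
exists K; exists n2 => // i /= hi a1 b1 a2 b2 fp b1_gt2 b2_lt.
have [i1 _ {}H3] := H3 i hi.
have b1_gt0 : (0 < b1)%N by apply: leq_trans b1_gt2.
have [a1_le a2_le det] : [/\ (a1 <= b1)%N, (a2 <= b2)%N &
    `|(a1 * b2)%:Z - (a2 * b1)%:Z| = 1].
  (* The formal pairs with 1/0 have b1 at most 1, so b1 > 2 leaves two genuine fractions. *)
  case/or3P: fp => /=.
  - by move=> /and3P[/and3P[_ ? _] /and3P[_ ? _] /eqP].
  - by case/andP => /eqP[_ b1E]; move: b1_gt2; rewrite b1E.
  - by case/andP => /eqP[_ b1E]; move: b1_gt2; rewrite b1E.
have ee1 : ((a2 * b1)%:Z - (a1 * b2)%:Z) * ((a2 * b1)%:Z - (a1 * b2)%:Z) = 1.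
  by rewrite -expr2 -sqrrN opprB -real_normK ?num_real // det expr1n.
have [_] := H3 a1 b1 a2 b2 _ b1_gt0 erefl ee1 a1_le (leq_add a1_le a2_le) b2_lt.
rewrite /cone_frac /cone_num /cone_den !muln1 !natrD ![(_ * (_ %/ _))%:R]natrM.
by rewrite -(ratioE i b1).
Qed.
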